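(* (i) For connected graphs $O_1,O_2$ and $T\in\{DPO,SPO_A,SPO_B,SPO_{AB}\}$, the contributions along non-trivial matches are $$\tilde O_1\circledast_T\tilde O_2=\sum_m\delta([O_{1_m2},O_{1_m2},\mathrm{id}_{O_{1_m2}}]),$$ $$\breve O_1\circledast_{DPO}\breve O_2=\delta_{O_1\cong O_2}\,|\mathrm{Aut}(O_1)|\,\breve O_1,$$ $$\breve O_1\circledast_{SPO_A}\breve O_2=\delta_{O_1\subseteq O_2}\sum_m\delta([O_2,\,O_1\uplus(O_2\setminus\mathrm{dom}(m)),\,\emptyset]),$$ $$\breve O_1\circledast_{SPO_B}\breve O_2=\delta_{O_2\subseteq O_1}\sum_m\delta([(O_1\setminus\mathrm{im}(m))\uplus O_2,\,O_1,\,\emptyset]),$$ $$\breve O_1\circledast_{SPO_{AB}}\breve O_2=\sum_m\delta([(O_1\setminus\mathrm{im}(m))\uplus O_2,\,O_1\uplus(O_2\setminus\mathrm{dom}(m)),\,\emptyset]),$$ where the sums run over the non-trivial matches $m$ contributing to the respective composition, and $O_{1_m2}$ is the graph obtained by overlapping $O_1$ with $O_2$ along the common subgraph matched by $m$. Consequently, $\mathcal O_T$ is a proper subalgebra of $\mathcal R_T$ for all types $T$, and so is $\mathcal O^\pm_{DPO}$ of $\mathcal R_{DPO}$, but for $T\ne DPO$, $\mathcal O^\pm_T$ is not a subalgebra of $\mathcal R_T$ (it is not closed under $*_T$). (ii) $\mathcal O_T$ (for every $T$) and $\mathcal O^\pm_{DPO}$ are commutative.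
   Context: $\mathbb K$ is a field (such as $\mathbb R$ or $\mathbb C$). Graphs are finite directed multigraphs (loops allowed). A linear rule $r:I\rightharpoonup O$ is an injective partial graph morphism: a pair of one-to-one relations $r\subseteq(V_I\times V_O)\uplus(E_I\times E_O)$ (distinct pairs differ in both entries) with $(e,e')\in r\Rightarrow(s(e),s(e')),(t(e),t(e'))\in r$ for edges. $[I,O,r]$ denotes its isomorphism class (under pairs of graph isomorphisms of $I$ and of $O$). The vector space underlying the rule algebra $\mathcal R_T$ has as basis the isomorphism classes of linear rules, $\delta([I,O,r])$ being the basis vectors; $r_\emptyset=\delta([\emptyset,\emptyset,\emptyset])$. The superposition $\uplus$ is the bilinear operation given on basis elements by disjoint union of rules. Product. For rules $\rho_1=[I_1,O_1,r_1]$, $\rho_2=[I_2,O_2,r_2]$ a match is a one-to-one relation $m$ from $O_2$ to $I_1$ (vertices to vertices, edges to edges, possibly empty) such that for matched edges $(e,e')\in m$ also $(s(e),s(e')),(t(e),t(e'))\in m$. The composite along $m$ has interfaces $\mathcal I=I_2\uplus(I_1\setminus\mathrm{im}(m))$, $\mathcal O=O_1\uplus(O_2\setminus\mathrm{dom}(m))$ (here only matched vertices and edges are removed); the relation from $\mathcal I$ to $\mathcal O$ is the restriction of $r_1\cup r_2\cup (r_1\circ m\circ r_2)$. An edge of $I_1$ in $\mathcal I$ whose endpoint $v$ is matched, $(v',v)\in m$, gets as endpoint the $w\in I_2$ with $(w,v')\in r_2$ if it exists, and otherwise the endpoint is missing; an edge of $O_2$ in $\mathcal O$ whose endpoint $v'$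 is matched, $(v',v)\in m$, gets as endpoint the $w\in O_1$ with $(v,w)\in r_1$ if it exists, and otherwise it is missing; all other endpoints are unchanged. Edges with a missing endpoint are called dangling. Reduction of type $T$: for $DPO$ the composite is replaced by $0$ if there is a dangling edge; for $SPO_A$ dangling edges in $\mathcal O$ are deleted (restricting the relation) and the result is $0$ if there are dangling edges in $\mathcal I$; for $SPO_B$ dangling edges in $\mathcal I$ are deleted and the result is $0$ if there are dangling edges in $\mathcal O$; for $SPO_{AB}$ all dangling edges are deleted. $\delta(\rho_1)*_T\delta(\rho_2)$ is the sum over all matches $m$ of the reduced composites, extended bilinearly; $\mathcal R_T$ is an associative algebra with unit $r_\emptyset$. $x\circledast_T y:=x*_Ty-x\uplus y$ is the contribution of the non-empty (non-trivial) matches. Elements. For a graph $O$: $\tilde O:=\delta([O,O,\mathrm{id}_O])$, $\breve O:=\delta([O,O,\emptyset])$. $\mathcal O_T\subset\mathcal R_T$ is the linear span of all $\tilde O$, and $\mathcal O^\pm_T\subset\mathcal R_T$ the linear span of all $\breve O$, over all isomorphism classes of finite graphs $O$. In the theorem, matches $m$ for $O_1,O_2$ are non-empty injective partial graph morphisms from $O_2$ to $O_1$ for which the reduced composite is non-zero; connected graphs are non-empty. $O_2\setminus\mathrm{dom}(m)$ and $O_1\setminus\mathrm{im}(m)$ in the formulas are the graphs obtained by deleting the matched vertices and edges and also all edges incident to deleted vertices. $\delta_{G\subseteq H}$ is $1$ if $G$ is isomorphic to a (not necessarily proper) subgraph of $H$, else $0$; $\delta_{G\cong H}$ similarly; $\mathrm{Aut}$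 is the automorphism group of the multigraph (acting on vertices and edges). *)

(* Defs.v *)
From HB Require Import structures.
From mathcomp Require Import all_boot all_algebra finmap.
From mathcomp.multinomials Require Import monalg.

Set Implicit Arguments.
Unset Strict Implicit.
Unset Printing Implicit Defensive.

Import GRing.Theory.

Record mgraph : Type := MGraph {
  vert : finType;
  edge : finType;
  src : edge -> vert;
  tgt : edge -> vert
}.

Definition empty_graph : mgraph :=
  @MGraph void void (fun e => e) (fun e => e).

Definition gsum (G H : mgraph) : mgraph :=
  @MGraph (vert G + vert H)%type (edge G + edge H)%type
    (fun e => match e with inl x => inl (src x) | inr y => inr (src y) end)
    (fun e => match e with inl x => inl (tgt x) | inr y => inr (tgt y) end).

Definition bijb (A B : finType) (f : {ffun A -> B}) : bool :=
  injectiveb f && [forall y, exists x, f x == y].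

Definition is_giso (G H : mgraph)
    (f : {ffun vert G -> vert H} * {ffun edge G -> edge H}) : bool :=
  [&& bijb f.1, bijb f.2 &
    [forall e, (f.1 (src e) == src (f.2 e)) && (f.1 (tgt e) == tgt (f.2 e))]].

Definition gisos (G H : mgraph) :
    {set {ffun vert G -> vert H} * {ffun edge G -> edge H}} :=
  [set f | is_giso f].

Definition giso (G H : mgraph) : bool := gisos G H != set0.

Definition Aut (G : mgraph) := gisos G G.

(* G \ D: the edges incident to a deleted vertex are deleted as well. *)
Section Deletion.
Variables (G : mgraph) (DV : {set vert G}) (DE : {set edge G}).

Definition kept_edge (e : edge G) : bool :=
  [&& e \notin DE, src e \notin DV & tgt e \notin DV].

Lemma kept_src (e : {e | kept_edge e}) : src (val e) \notin DV.
Proof. by case/and3P: (valP e). Qed.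

Lemma kept_tgt (e : {e | kept_edge e}) : tgt (val e) \notin DV.
Proof. by case/and3P: (valP e). Qed.

Definition gdel : mgraph :=
  @MGraph {v : vert G | v \notin DV} {e : edge G | kept_edge e}
    (fun e => exist _ (src (val e)) (kept_src e))
    (fun e => exist _ (tgt (val e)) (kept_tgt e)).

End Deletion.

(* The subgraphs of H are the graphs obtained from H by deletion. *)
Definition subgraph_iso (G H : mgraph) : bool :=
  [exists D : {set vert H} * {set edge H}, giso G (gdel D.1 D.2)].

Definition adj (G : mgraph) : rel (vert G) := fun u v =>
  [exists e : edge G,
    ((src e == u) && (tgt e == v)) || ((src e == v) && (tgt e == u))].

(* Connectedness ignores the orientation of the edges. *)
Definition connected (G : mgraph) : bool :=
  (0 < #|vert G|)%N && [forall u, forall v, connect (@adj G) u v].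

Definition one_to_one (A B : finType) (r : {set A * B}) : bool :=
  [forall p in r, forall q in r, (p != q) ==> (p.1 != q.1) && (p.2 != q.2)].

Definition pgm_ok (G H : mgraph)
    (r : {set vert G * vert H} * {set edge G * edge H}) : bool :=
  [&& one_to_one r.1, one_to_one r.2 &
    [forall p in r.2, ((src p.1, src p.2) \in r.1) &&
                      ((tgt p.1, tgt p.2) \in r.1)]].

(* Linear rules and matches are both injective partial graph morphisms. *)
Record pgm (G H : mgraph) := Pgm {
  pgm_val :> {set vert G * vert H} * {set edge G * edge H};
  pgmP : pgm_ok pgm_val
}.

HB.instance Definition _ (G H : mgraph) := [isSub for @pgm_val G H].
HB.instance Definition _ (G H : mgraph) := [Finite of pgm G H by <:].

Definition relV (G H : mgraph) (r : pgm G H) := (pgm_val r).1.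
Definition relE (G H : mgraph) (r : pgm G H) := (pgm_val r).2.

Lemma one_to_oneP (A B : finType) (r : {set A * B}) :
  reflect ((forall a b b', (a, b) \in r -> (a, b') \in r -> b = b') /\
           (forall a a' b, (a, b) \in r -> (a', b) \in r -> a = a'))
    (one_to_one r).
Proof.
apply: (iffP forall_inP) => [h|[hl hr] [a b] hp].
  split=> [a b b' h1 h2|a a' b h1 h2]; apply/eqP; apply: contraT => ne.
    have /forall_inP/(_ _ h2)/implyP := h _ h1.
    by rewrite xpair_eqE eqxx ne => /(_ isT).
  have /forall_inP/(_ _ h2)/implyP := h _ h1.
  by rewrite xpair_eqE eqxx andbT ne andbF => /(_ isT).
apply/forall_inP=> -[a' b'] hq; apply/implyP; apply: contraR => /=.
rewrite negb_and !negbK => /orP[] /eqP e.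
  by rewrite -e in hq *; rewrite (hl _ _ _ hp hq).
by rewrite -e in hq *; rewrite (hr _ _ _ hp hq).
Qed.

Lemma relE_src (G H : mgraph) (r : pgm G H) e f :
  (e, f) \in relE r -> (src e, src f) \in relV r.
Proof.
move=> h; case/and3P: (pgmP r) => _ _ /forall_inP/(_ _ h) /=.
by case/andP.
Qed.

Lemma relE_tgt (G H : mgraph) (r : pgm G H) e f :
  (e, f) \in relE r -> (tgt e, tgt f) \in relV r.
Proof.
move=> h; case/and3P: (pgmP r) => _ _ /forall_inP/(_ _ h) /=.
by case/andP.
Qed.

Lemma relV_inj (G H : mgraph) (r : pgm G H) : one_to_one (relV r).
Proof. by case/and3P: (pgmP r). Qed.

Lemma relE_inj (G H : mgraph) (r : pgm G H) : one_to_one (relE r).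
Proof. by case/and3P: (pgmP r). Qed.

Lemma pgm_okI (G H : mgraph) (rv : {set vert G * vert H})
    (re : {set edge G * edge H}) :
  one_to_one rv -> one_to_one re ->
  (forall e f, (e, f) \in re ->
     (src e, src f) \in rv /\ (tgt e, tgt f) \in rv) ->
  pgm_ok (rv, re).
Proof.
move=> h1 h2 h3; apply/and3P; split=> //; apply/forall_inP=> -[e f] /= /h3.
by case=> -> ->.
Qed.

Fact pgm0_ok (G H : mgraph) : @pgm_ok G H (set0, set0).
Proof.
apply: pgm_okI=> [||e f]; rewrite ?inE //;
  by apply/one_to_oneP; split=> [a b b'|a a' b]; rewrite inE.
Qed.

Definition pgm0 (G H : mgraph) : pgm G H := Pgm (pgm0_ok G H).

Definition diag (A : finType) : {set A * A} := [set p | p.1 == p.2].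

Lemma diag_inj (A : finType) : one_to_one (diag A).
Proof.
by apply/one_to_oneP; split=> [a b b'|a a' b];
  rewrite !inE /= => /eqP<- /eqP.
Qed.

Fact pgm_id_ok (G : mgraph) : @pgm_ok G G (diag (vert G), diag (edge G)).
Proof.
apply: pgm_okI=> [||e f]; rewrite ?diag_inj // !inE /= => /eqP<-.
by rewrite !eqxx.
Qed.

Definition pgm_id (G : mgraph) : pgm G G := Pgm (pgm_id_ok G).

Record lrule : Type := LRule {
  inp : mgraph;
  out : mgraph;
  lrel : pgm inp out
}.

Definition img2 (A A' B B' : finType) (f : A -> A') (g : B -> B')
    (r : {set A * B}) : {set A' * B'} := [set (f p.1, g p.2) | p in r].

Definition rule_iso (r s : lrule) : bool :=
  [exists f in gisos (inp r) (inp s), exists g in gisos (out r) (out s),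
    (img2 f.1 g.1 (relV (lrel r)) == relV (lrel s)) &&
    (img2 f.2 g.2 (relE (lrel r)) == relE (lrel s))].

Definition rel_sum (A B A' B' : finType) (r : {set A * B}) (s : {set A' * B'}) :
    {set (A + A') * (B + B')} :=
  [set p | match p with
           | (inl a, inl b) => (a, b) \in r
           | (inr a, inr b) => (a, b) \in s
           | _ => false
           end].

Lemma rel_sum_inj (A B A' B' : finType) (r : {set A * B})
    (s : {set A' * B'}) :
  one_to_one r -> one_to_one s -> one_to_one (rel_sum r s).
Proof.
case/one_to_oneP=> r1 r2 /one_to_oneP[s1 s2]; apply/one_to_oneP.
split=> [[a|a] [b|b] [b'|b']|[a|a] [a'|a'] [b|b]]; rewrite !inE // => h1 h2.
- by rewrite (r1 _ _ _ h1 h2).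
- by rewrite (s1 _ _ _ h1 h2).
- by rewrite (r2 _ _ _ h1 h2).
- by rewrite (s2 _ _ _ h1 h2).
Qed.

Fact pgm_sum_ok (G H G' H' : mgraph) (r : pgm G H) (s : pgm G' H') :
  @pgm_ok (gsum G G') (gsum H H')
    (rel_sum (relV r) (relV s), rel_sum (relE r) (relE s)).
Proof.
apply: pgm_okI=> [||[e|e] [f|f]]; rewrite ?rel_sum_inj ?relV_inj ?relE_inj //
  inE // => h; split; rewrite inE; [exact: relE_src|exact: relE_tgt
                                   |exact: relE_src|exact: relE_tgt].
Qed.

Definition pgm_sum (G H G' H' : mgraph) (r : pgm G H) (s : pgm G' H') :
    pgm (gsum G G') (gsum H H') := Pgm (pgm_sum_ok r s).

Definition rule_sum (r s : lrule) : lrule :=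
  LRule (pgm_sum (lrel r) (lrel s)).

(* A missing endpoint is None. *)
Record pregraph : Type := PreGraph {
  pvert : finType;
  pedge : finType;
  psrc : pedge -> option pvert;
  ptgt : pedge -> option pvert
}.

Definition dangling (P : pregraph) (e : pedge P) : bool :=
  ~~ (psrc e && ptgt e).

Definition has_dangling (P : pregraph) : bool := [exists e : pedge P, dangling e].

Definition oget (T : Type) (o : option T) : o -> T :=
  match o with
  | Some x => fun _ => x
  | None => fun h => match notF h with end
  end.

Lemma ogetK (T : Type) (o : option T) (h : o) : Some (oget h) = o.
Proof. by case: o h. Qed.

Section Trim.
Variable P : pregraph.

Lemma trim_src (e : {e : pedge P | ~~ dangling e}) : psrc (val e).
Proof. by case/andP: (negPn (valP e)). Qed.

Lemma trim_tgt (e : {e : pedge P | ~~ dangling e}) : ptgt (val e).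
Proof. by case/andP: (negPn (valP e)). Qed.

Definition trim : mgraph :=
  @MGraph (pvert P) {e : pedge P | ~~ dangling e}
    (fun e => oget (trim_src e)) (fun e => oget (trim_tgt e)).

End Trim.

Definition rdom (A B : finType) (r : {set A * B}) : {set A} :=
  [set p.1 | p in r].
Definition rim (A B : finType) (r : {set A * B}) : {set B} :=
  [set p.2 | p in r].

Definition rcomp (A B C : finType) (s : {set B * C}) (r : {set A * B}) :
    {set A * C} :=
  [set p | [exists b, ((p.1, b) \in r) && ((b, p.2) \in s)]].

Lemma rcompP (A B C : finType) (s : {set B * C}) (r : {set A * B}) a c :
  reflect (exists2 b, (a, b) \in r & (b, c) \in s) ((a, c) \in rcomp s r).
Proof.
rewrite inE; apply: (iffP existsP) => [[b /andP[]]|[b h1 h2]]; exists b => //.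
by rewrite h1.
Qed.

Lemma rcomp_inj (A B C : finType) (s : {set B * C}) (r : {set A * B}) :
  one_to_one s -> one_to_one r -> one_to_one (rcomp s r).
Proof.
case/one_to_oneP=> s1 s2 /one_to_oneP[r1 r2]; apply/one_to_oneP.
split=> [a c c' /rcompP[b hr hs] /rcompP[b' hr' hs']
        |a a' c /rcompP[b hr hs] /rcompP[b' hr' hs']].
  by rewrite -(r1 _ _ _ hr hr') in hs'; apply: s1 hs hs'.
by rewrite -(s2 _ _ _ hs hs') in hr'; apply: r2 hr hr'.
Qed.

(* The relation between I2 + (I1 \ im m) and O1 + (O2 \ dom m): the
   restriction of r1 \cup r2 \cup (r1 \o m \o r2) *)
Section GlueRel.
Variables I1 O1 I2 O2 : finType.
Variables (r1 : {set I1 * O1}) (r2 : {set I2 * O2}) (m : {set O2 * I1}).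

Definition glue_rel :
    {set (I2 + {x | x \notin rim m}) * (O1 + {y | y \notin rdom m})} :=
  [set p | match p with
           | (inl a, inl b) => (a, b) \in rcomp r1 (rcomp m r2)
           | (inl a, inr b) => (a, val b) \in r2
           | (inr a, inl b) => (val a, b) \in r1
           | (inr _, inr _) => false
           end].

Lemma in_glue_rel p : (p \in glue_rel) =
  match p with
  | (inl a, inl b) => (a, b) \in rcomp r1 (rcomp m r2)
  | (inl a, inr b) => (a, val b) \in r2
  | (inr a, inl b) => (val a, b) \in r1
  | (inr _, inr _) => false
  end.
Proof. by rewrite in_set. Qed.

Lemma glue_rel_inj :
  one_to_one r1 -> one_to_one r2 -> one_to_one m -> one_to_one glue_rel.
Proof.
move=> h1 h2 hm; have /one_to_oneP[c1 c2] :=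
  rcomp_inj h1 (rcomp_inj hm h2).
case/one_to_oneP: h1=> r11 r12; case/one_to_oneP: h2=> r21 r22.
have A (a : I2) (b : O1) (b' : {y | y \notin rdom m}) :
    (a, b) \in rcomp r1 (rcomp m r2) -> (a, val b') \in r2 -> False.
  case/rcompP=> x /rcompP[y hy hx] _ /(r21 _ _ _ hy) e.
  by case/negP: (valP b'); apply/imsetP; exists (y, x).
have B (a : I2) (b : O1) (a' : {x | x \notin rim m}) :
    (a, b) \in rcomp r1 (rcomp m r2) -> (val a', b) \in r1 -> False.
  case/rcompP=> x /rcompP[y _ hx] hb /(r12 _ _ _ hb) e.
  by case/negP: (valP a'); apply/imsetP; exists (y, x).
apply/one_to_oneP; split=> [[a|a] [b|b] [b'|b']|[a|a] [a'|a'] [b|b]];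
  rewrite !in_glue_rel // => k k'.
- by rewrite (c1 _ _ _ k k').
- by case: (A _ _ _ k k').
- by case: (A _ _ _ k' k).
- by congr inr; apply: val_inj; apply: r21 k k'.
- by rewrite (r11 _ _ _ k k').
- by rewrite (c2 _ _ _ k k').
- by rewrite (r22 _ _ _ k k').
- by case: (B a b a' k k').
- by case: (B _ _ _ k' k).
- by congr inr; apply: val_inj; apply: r12 k k'.
Qed.

End GlueRel.

Section Composite.
Variables I1 O1 I2 O2 : mgraph.
Variables (r1 : pgm I1 O1) (r2 : pgm I2 O2) (m : pgm O2 I1).

Definition comp_inp_vert : finType :=
  (vert I2 + {v : vert I1 | v \notin rim (relV m)})%type.
Definition comp_out_vert : finType :=
  (vert O1 + {v : vert O2 | v \notin rdom (relV m)})%type.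

(* The new position of a vertex of I1 (resp. of O2), as an endpoint of an
   edge of the composite. *)
Definition inp_end (v : vert I1) : option comp_inp_vert :=
  match insub v with
  | Some u => Some (inr u)
  | None => omap inl [pick w | (w, v) \in rcomp (relV m) (relV r2)]
  end.
Definition out_end (v : vert O2) : option comp_out_vert :=
  match insub v with
  | Some u => Some (inr u)
  | None => omap inl [pick w | (v, w) \in rcomp (relV r1) (relV m)]
  end.

Definition comp_inp : pregraph :=
  @PreGraph comp_inp_vert (edge I2 + {e : edge I1 | e \notin rim (relE m)})%type
    (fun e => match e with
              | inl x => Some (inl (src x))
              | inr y => inp_end (src (val y))
              end)
    (fun e => match e with
              | inl x => Some (inl (tgt x))
              | inr y => inp_end (tgt (val y))
              end).

Definition comp_out : pregraph :=
  @PreGraph comp_out_vert (edge O1 + {e : edge O2 | e \notin rdom (relE m)})%type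
    (fun e => match e with
              | inl x => Some (inl (src x))
              | inr y => out_end (src (val y))
              end)
    (fun e => match e with
              | inl x => Some (inl (tgt x))
              | inr y => out_end (tgt (val y))
              end).

Definition comp_relV : {set vert (trim comp_inp) * vert (trim comp_out)} :=
  glue_rel (relV r1) (relV r2) (relV m).
Definition comp_relE : {set edge (trim comp_inp) * edge (trim comp_out)} :=
  [set p | (val p.1, val p.2) \in glue_rel (relE r1) (relE r2) (relE m)].

Lemma inp_end_rel v w x :
  (v, w) \in relV r1 -> inp_end v = Some x ->
  (x, inl w) \in glue_rel (relV r1) (relV r2) (relV m).
Proof.
move=> h; rewrite /inp_end; case: insubP => [u _ e [<-]|_].
  by rewrite in_glue_rel e.
case: pickP => //= z hz [<-]; rewrite in_glue_rel; apply/rcompP; by exists v.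
Qed.

Lemma out_end_rel v w x :
  (w, v) \in relV r2 -> out_end v = Some x ->
  (inl w, x) \in glue_rel (relV r1) (relV r2) (relV m).
Proof.
move=> h; rewrite /out_end; case: insubP => [u _ e [<-]|_].
  by rewrite in_glue_rel e.
case: pickP => //= z /rcompP[y h1 h2] [<-]; rewrite in_glue_rel.
by apply/rcompP; exists y => //; apply/rcompP; exists v.
Qed.

Fact comp_ok : pgm_ok (comp_relV, comp_relE).
Proof.
apply: pgm_okI.
- by rewrite glue_rel_inj ?relV_inj.
- have /one_to_oneP[g1 g2] :=
    glue_rel_inj (relE_inj r1) (relE_inj r2) (relE_inj m).
  apply/one_to_oneP; split=> [a b b'|a a' b];
    rewrite ![_ \in comp_relE]in_set => h1 h2;
    apply: val_inj.
    exact: g1 h1 h2.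
  exact: g2 h1 h2.
move=> e f; rewrite [_ \in comp_relE]in_set /=.
move: (trim_src e) (trim_tgt e) (trim_src f) (trim_tgt f).
case: e f => [[e|e] he] [[f|f] hf] /= es et fs ft; rewrite in_glue_rel.
- case/rcompP=> y /rcompP[x h1 h2] h3.
  split; rewrite in_glue_rel; apply/rcompP.
    exists (src y); last exact: relE_src.
    by apply/rcompP; exists (src x); apply: relE_src.
  exists (tgt y); last exact: relE_tgt.
  by apply/rcompP; exists (tgt x); apply: relE_tgt.
- move=> h; split; apply: out_end_rel.
  + exact: relE_src h.
  + by rewrite ogetK.
  + exact: relE_tgt h.
  + by rewrite ogetK.
- move=> h; split; apply: inp_end_rel.
  + exact: relE_src h.
  + by rewrite ogetK.
  + exact: relE_tgt h.
  + by rewrite ogetK.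
- by [].
Qed.

(* All dangling edges are deleted: for the types that keep an interface as it
   is, the reduced composite is 0 as soon as that interface has any. *)
Definition comp_rule : lrule := LRule (Pgm comp_ok).

End Composite.

Variant rtype := DPO | SPOA | SPOB | SPOAB.

Definition inp_strict (T : rtype) : bool :=
  match T with DPO | SPOA => true | SPOB | SPOAB => false end.
Definition out_strict (T : rtype) : bool :=
  match T with DPO | SPOB => true | SPOA | SPOAB => false end.

(* Reduction in the composite "r after s" along m; None stands for the zero
   vector. *)
Definition reduct (T : rtype) (r s : lrule) (m : pgm (out s) (inp r)) :
    option lrule :=
  if (inp_strict T && has_dangling (comp_inp (lrel s) m)) ||
     (out_strict T && has_dangling (comp_out (lrel r) m))
  then None
  else Some (comp_rule (lrel r) (lrel s) m).

Definition contributes (T : rtype) (r s : lrule) (m : pgm (out s) (inp r)) :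
    bool := (m != pgm0 _ _) && reduct T m.

(* The isomorphism classes of rules form a choiceType: every rule is isomorphic
   to one between graphs on ordinals. *)

Definition ograph_fam (d : nat * nat) : choiceType :=
  ({ffun 'I_d.2 -> 'I_d.1} * {ffun 'I_d.2 -> 'I_d.1})%type.

Definition ograph : choiceType := {d : nat * nat & ograph_fam d}.

Definition of_ograph (g : ograph) : mgraph :=
  @MGraph 'I_(tag g).1 'I_(tag g).2 (tagged g).1 (tagged g).2.

Definition to_ograph (G : mgraph) : ograph :=
  @existT (nat * nat) ograph_fam (#|vert G|, #|edge G|)
   ([ffun i => enum_rank (src (enum_val i))],
    [ffun i => enum_rank (tgt (enum_val i))]).

Definition orule_fam (gh : ograph * ograph) : choiceType :=
  pgm (of_ograph gh.1) (of_ograph gh.2).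

Definition orule : choiceType := {gh : ograph * ograph & orule_fam gh}.

Definition of_orule (r : orule) : lrule :=
  @LRule (of_ograph (tag r).1) (of_ograph (tag r).2) (tagged r).

Lemma img2_inj (A A' B B' : finType) (f : A -> A') (g : B -> B') r :
  injective f -> injective g -> one_to_one r -> one_to_one (img2 f g r).
Proof.
move=> fI gI /one_to_oneP[r1 r2]; apply/one_to_oneP; split.
  move=> a b b' /imsetP[[x y] h [ea ->]] /imsetP[[x' y'] h' [ea' ->]] /=.
  move: ea; rewrite ea' => /fI e.
  by rewrite /= in e; rewrite e in h'; rewrite (r1 _ _ _ h h').
move=> a a' b /imsetP[[x y] h [-> eb]] /imsetP[[x' y'] h' [-> eb']] /=.
move: eb; rewrite eb' => /gI e.
by rewrite /= in e; rewrite e in h'; rewrite (r2 _ _ _ h h').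
Qed.

Fact to_orule_ok (r : lrule) :
  @pgm_ok (of_ograph (to_ograph (inp r))) (of_ograph (to_ograph (out r)))
    (img2 enum_rank enum_rank (relV (lrel r)),
     img2 enum_rank enum_rank (relE (lrel r))).
Proof.
apply: pgm_okI.
- by rewrite img2_inj ?relV_inj //; apply: enum_rank_inj.
- by rewrite img2_inj ?relE_inj //; apply: enum_rank_inj.
move=> e f /imsetP[[x y] h [-> ->]] /=; rewrite !ffunE !enum_rankK.
split; apply/imsetP.
  by exists (src x, src y) => //; apply: relE_src.
by exists (tgt x, tgt y) => //; apply: relE_tgt.
Qed.

Definition to_orule (r : lrule) : orule :=
  @existT _ orule_fam (to_ograph (inp r), to_ograph (out r))
    (Pgm (to_orule_ok r)).

Lemma bijbP (A B : finType) (f : {ffun A -> B}) :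
  reflect (bijective f) (bijb f).
Proof.
apply: (iffP andP) => [[/injectiveP fI /forallP fS]|fB].
  have fS' y : exists x, f x == y by apply/existsP/fS.
  exists (fun y => xchoose (fS' y)) => [x|y].
    by apply: fI; apply/eqP; apply: (xchooseP (fS' (f x))).
  by apply/eqP; apply: (xchooseP (fS' y)).
split; first by apply/injectiveP; apply: bij_inj.
by apply/forallP=> y; apply/existsP; case: fB => g _ gK; exists (g y);
  rewrite gK.
Qed.

Lemma gisosP (G H : mgraph)
    (f : {ffun vert G -> vert H} * {ffun edge G -> edge H}) :
  reflect [/\ bijective f.1, bijective f.2,
     forall e, f.1 (src e) = src (f.2 e) & forall e, f.1 (tgt e) = tgt (f.2 e)]
   (f \in gisos G H).
Proof.
rewrite inE; apply: (iffP and3P) => [[/bijbP h1 /bijbP h2 /forallP h]|].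
  by split=> // e; case/andP: (h e) => /eqP ? /eqP.
by case=> h1 h2 h3 h4; split; [exact/bijbP|exact/bijbP|];
  apply/forallP=> e; rewrite h3 h4 !eqxx.
Qed.

Lemma img2_id (A B : finType) (f : A -> A) (g : B -> B) r :
  f =1 id -> g =1 id -> img2 f g r = r.
Proof.
move=> hf hg; rewrite /img2 -[RHS]imset_id; apply: eq_imset => -[a b] /=.
by rewrite hf hg.
Qed.

Lemma img2_comp (A A' A'' B B' B'' : finType) (f : A -> A') (g : B -> B')
    (f' : A' -> A'') (g' : B' -> B'') r :
  img2 f' g' (img2 f g r) = img2 (f' \o f) (g' \o g) r.
Proof. by rewrite /img2 -imset_comp. Qed.

Lemma eq_img2 (A A' B B' : finType) (f f' : A -> A') (g g' : B -> B') r :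
  f =1 f' -> g =1 g' -> img2 f g r = img2 f' g' r.
Proof. by move=> hf hg; apply: eq_imset => -[a b] /=; rewrite hf hg. Qed.

Lemma gisos_id (G : mgraph) : ([ffun v => v], [ffun e => e]) \in gisos G G.
Proof.
apply/gisosP; split=> /= [||e|e]; rewrite ?ffunE //;
 by exists id => x; rewrite ffunE.
Qed.

Lemma gisos_comp (G H L : mgraph) f g : f \in gisos G H -> g \in gisos H L ->
  ([ffun v => g.1 (f.1 v)], [ffun e => g.2 (f.2 e)]) \in gisos G L.
Proof.
case/gisosP=> f1 f2 f3 f4 /gisosP[g1 g2 g3 g4]; apply/gisosP; split=> /=.
- by apply: (eq_bij (bij_comp g1 f1)) => x; rewrite ffunE.
- by apply: (eq_bij (bij_comp g2 f2)) => x; rewrite ffunE.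
- by move=> e; rewrite !ffunE f3 g3.
- by move=> e; rewrite !ffunE f4 g4.
Qed.

Lemma gisos_inv (G H : mgraph) f : f \in gisos G H ->
  exists2 g, g \in gisos H G & [/\ cancel f.1 g.1 & cancel f.2 g.2].
Proof.
case/gisosP=> -[v fv vf] [e fe ef] h1 h2.
exists ([ffun x => v x], [ffun x => e x]); last first.
  by split=> x /=; rewrite ffunE.
apply/gisosP; split=> /=.
- by exists f.1 => x; rewrite ffunE.
- by exists f.2 => x; rewrite ffunE.
- by move=> x; rewrite !ffunE -{1}(ef x) -h1 fv.
- by move=> x; rewrite !ffunE -{1}(ef x) -h2 fv.
Qed.

Lemma rule_isoP (r s : lrule) :
  reflect (exists f g, [/\ f \in gisos (inp r) (inp s),
      g \in gisos (out r) (out s),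
      img2 f.1 g.1 (relV (lrel r)) = relV (lrel s) &
      img2 f.2 g.2 (relE (lrel r)) = relE (lrel s)])
    (rule_iso r s).
Proof.
apply: (iffP exists_inP) => [[f hf /exists_inP[g hg /andP[/eqP h1 /eqP h2]]]|].
  by exists f, g.
case=> f [g [hf hg h1 h2]]; exists f => //; apply/exists_inP; exists g => //.
by rewrite h1 h2 !eqxx.
Qed.

Lemma rule_iso_refl : reflexive rule_iso.
Proof.
move=> r; apply/rule_isoP; exists ([ffun v => v], [ffun e => e]).
exists ([ffun v => v], [ffun e => e]); rewrite !gisos_id.
by split=> //; apply: img2_id => x; rewrite ffunE.
Qed.

Lemma rule_iso_trans : transitive rule_iso.
Proof.
move=> s r t /rule_isoP[f [g [hf hg h1 h2]]] /rule_isoP[f' [g' [hf' hg' k1 k2]]].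
apply/rule_isoP; have F := gisos_comp hf hf'; have G := gisos_comp hg hg'.
do 2!eexists; split; [exact: F|exact: G| |].
  by rewrite -k1 -h1 img2_comp; apply: eq_img2 => x; rewrite ffunE.
by rewrite -k2 -h2 img2_comp; apply: eq_img2 => x; rewrite ffunE.
Qed.

Lemma rule_iso_sym : symmetric rule_iso.
Proof.
suff h r s : rule_iso r s -> rule_iso s r by move=> r s; apply/idP/idP; apply: h.
case/rule_isoP=> f [g [/gisos_inv[f' hf' [f1 f2]] /gisos_inv[g' hg' [g1 g2]]]].
move=> h1 h2; apply/rule_isoP; exists f', g'; split=> //.
  by rewrite -h1 img2_comp; apply: img2_id.
by rewrite -h2 img2_comp; apply: img2_id.
Qed.

Lemma to_ograph_iso (G : mgraph) :
  ([ffun v => enum_rank v], [ffun e => enum_rank e])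
    \in gisos G (of_ograph (to_ograph G)).
Proof.
apply/gisosP; split=> /=.
- by apply: (eq_bij (@enum_rank_bij _)) => x; rewrite ffunE.
- by apply: (eq_bij (@enum_rank_bij _)) => x; rewrite ffunE.
- by move=> e; rewrite !ffunE enum_rankK.
- by move=> e; rewrite !ffunE enum_rankK.
Qed.

Lemma to_orule_iso (r : lrule) : rule_iso r (of_orule (to_orule r)).
Proof.
apply/rule_isoP; do 2!eexists.
split; [exact: to_ograph_iso|exact: to_ograph_iso| |];
  by apply: eq_img2 => x; rewrite ffunE.
Qed.

Definition orule_iso : rel orule :=
  fun r s => rule_iso (of_orule r) (of_orule s).

Lemma orule_iso_equiv : equiv_class_of orule_iso.
Proof.
split=> [r|r s|s r t]; rewrite /orule_iso; first exact: rule_iso_refl.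
  exact: rule_iso_sym.
exact: rule_iso_trans.
Qed.

Canonical orule_iso_equiv_rel := EquivRelPack orule_iso_equiv.

Local Open Scope quotient_scope.

Definition rclass : choiceType := {eq_quot orule_iso}.

Definition class_of (r : lrule) : rclass := \pi_({eq_quot orule_iso}) (to_orule r).
Definition rep (c : rclass) : lrule := of_orule (repr (c : {eq_quot orule_iso})).

Lemma class_ofP (r s : lrule) : (class_of r == class_of s) = rule_iso r s.
Proof.
rewrite /class_of eqmodE /= /orule_iso; apply/idP/idP => h.
  apply: rule_iso_trans (to_orule_iso r) (rule_iso_trans h _).
  by rewrite rule_iso_sym to_orule_iso.
apply: rule_iso_trans (rule_iso_trans h (to_orule_iso s)).
by rewrite rule_iso_sym to_orule_iso.
Qed.

Lemma repK (c : rclass) : class_of (rep c) = c.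
Proof.
rewrite -[RHS](@reprK _ {eq_quot orule_iso}); apply/eqP.
rewrite /class_of eqmodE /= /orule_iso rule_iso_sym.
exact: to_orule_iso.
Qed.

Local Close Scope quotient_scope.
Local Open Scope ring_scope.

Definition ralg (K : fieldType) : lmodType K := {malg K[rclass]}.

Definition delta (K : fieldType) (r : lrule) : ralg K := << class_of r >>.

(* Bilinear extension of a function on pairs of basis elements; all functions
   it is applied to are invariant under isomorphism of rules, so that the choice
   of the representatives is immaterial. *)
Definition bilin (K : fieldType) (f : lrule -> lrule -> ralg K)
    (x y : ralg K) : ralg K :=
  \sum_(c <- msupp x) \sum_(d <- msupp y)
     (x@_c * y@_d) *: f (rep c) (rep d).

Definition superpose (K : fieldType) : ralg K -> ralg K -> ralg K :=
  bilin (fun r s => delta K (rule_sum r s)).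

Definition rmul (K : fieldType) (T : rtype) : ralg K -> ralg K -> ralg K :=
  bilin (fun r s => \sum_(m : pgm (out s) (inp r))
                      oapp (delta K) 0 (reduct T m)).

Definition nontriv_mul (K : fieldType) (T : rtype) (x y : ralg K) : ralg K :=
  rmul T x y - superpose x y.

Definition runit (K : fieldType) : ralg K :=
  delta K (LRule (pgm0 empty_graph empty_graph)).

Definition tilde_rule (G : mgraph) : lrule := LRule (pgm_id G).
Definition breve_rule (G : mgraph) : lrule := LRule (pgm0 G G).

Definition tilde (K : fieldType) (G : mgraph) : ralg K := delta K (tilde_rule G).
Definition breve (K : fieldType) (G : mgraph) : ralg K := delta K (breve_rule G).

Definition lspan (K : fieldType) (J : Type) (f : J -> ralg K) (x : ralg K) :
    Prop :=
  exists s : seq (K * J), x = \sum_(p <- s) p.1 *: f p.2.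

(* All R_T have the same underlying vector space, hence these subspaces do not
   depend on T. *)
Definition obs (K : fieldType) : ralg K -> Prop := lspan (@tilde K).
Definition obs_pm (K : fieldType) : ralg K -> Prop := lspan (@breve K).

Definition mul_closed (K : fieldType) (T : rtype) (A : ralg K -> Prop) : Prop :=
  forall x y, A x -> A y -> A (rmul T x y).

(* Unital subalgebras *)
Definition subalgebra (K : fieldType) (T : rtype) (A : ralg K -> Prop) : Prop :=
  [/\ A (runit K), forall (a : K) x y, A x -> A y -> A (a *: x + y)
    & mul_closed T A].

Definition proper_subalgebra (K : fieldType) (T : rtype) (A : ralg K -> Prop) :
    Prop := subalgebra T A /\ exists x, ~ A x.

Definition commutative_on (K : fieldType) (T : rtype) (A : ralg K -> Prop) :
    Prop := forall x y, A x -> A y -> rmul T x y = rmul T y x.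

(* O1 and O2 overlapped along a match m from O2 to O1: the matched vertices and
   edges of O2 are identified with their images in O1. *)
Section Overlap.
Variables (O1 O2 : mgraph) (m : pgm O2 O1).

Lemma rdom_ex (v : vert O2) :
  v \in rdom (relV m) -> exists w, (v, w) \in relV m.
Proof. by case/imsetP=> -[a b] h ->; exists b. Qed.

Definition overlap_vert (v : vert O2) :
    (vert O1 + {u : vert O2 | u \notin rdom (relV m)})%type :=
  match boolP (v \in rdom (relV m)) with
  | AltTrue h => inl (xchoose (rdom_ex h))
  | AltFalse h => inr (exist _ v h)
  end.

Definition overlap : mgraph :=
  @MGraph (vert O1 + {v : vert O2 | v \notin rdom (relV m)})%type
    (edge O1 + {e : edge O2 | e \notin rdom (relE m)})%type
    (fun e => match e with
              | inl x => inl (src x)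
              | inr y => overlap_vert (src (val y))
              end)
    (fun e => match e with
              | inl x => inl (tgt x)
              | inr y => overlap_vert (tgt (val y))
              end).

End Overlap.

Definition del_dom (G H : mgraph) (m : pgm G H) : mgraph :=
  gdel (rdom (relV m)) (rdom (relE m)).
Definition del_im (G H : mgraph) (m : pgm G H) : mgraph :=
  gdel (rim (relV m)) (rim (relE m)).

(* Main.v *)
(** The product of two basis elements depends only on the isomorphism classes
    of the two rules, because matches can be transported along isomorphisms. The
    trivial match contributes the superposition, so the theorem is about the
    composites along the remaining matches.

    Composing along [m] two rules whose relations are contained in the identity,
    and provided that no edge is left dangling, each of the two interfaces is
    [O1] and [O2] overlapped along [m]; this settles the algebra of the rules
    [tilde O] for all types and that of the rules [breve O] for DPO. The overlap
    is insensitive to replacing [m] by its converse, whence commutativity.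

    For [breve O] with [O] connected, the absence of dangling edges in an
    interface says that the set of matched vertices is closed under adjacency,
    hence that a nontrivial match is total on that side. For DPO it is an
    isomorphism. For the other types, a vertex and a vertex with a loop yield a
    composite whose two interfaces are not isomorphic. *)

Require Import Defs.
From mathcomp Require Import all_boot all_algebra finmap.
From mathcomp.multinomials Require Import monalg.

Set Implicit Arguments.
Unset Strict Implicit.
Unset Printing Implicit Defensive.

Import GRing.Theory.
Local Open Scope ring_scope.

(** * Isomorphisms as bijective relations *)

(** Bijections are given as relations because the vertices and edges of a composite live in sums and
    subtypes: saying when two elements correspond avoids maps that would have to produce membership
    proofs. *)
Definition bijrel (A B : Type) (R : A -> B -> bool) : Prop :=
  [/\ forall a, exists b, R a b, forall b, exists a, R a b,
      forall a b b', R a b -> R a b' -> b = b'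
    & forall a a' b, R a b -> R a' b -> a = a'].

Lemma bijrel_fun (A B : finType) (R : A -> B -> bool) : bijrel R ->
  exists2 f : {ffun A -> B}, bijective f & forall a b, R a b = (f a == b).
Proof.
case=> t s u i; pose f := [ffun a => xchoose (t a)].
have fR a : R a (f a) by rewrite ffunE; apply: xchooseP.
exists f; last first.
  by move=> a b; apply/idP/eqP => [/(u _ _ _ (fR a))|<-].
exists (fun b => xchoose (s b)) => [a|b].
  by apply: i (xchooseP (s _)) (fR a).
by apply: u (fR _) (xchooseP (s b)).
Qed.

Lemma bijrel_graph (A B : eqType) (f : A -> B) :
  bijective f -> bijrel (fun a b => f a == b).
Proof.
move=> fB; have fI := bij_inj fB; case: fB => g fK gK; split.
- by move=> a; exists (f a).
- by move=> b; exists (g b); rewrite gK.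
- by move=> a b b' /eqP-> /eqP.
- by move=> a a' b /eqP<- /eqP/fI.
Qed.

Lemma bijrel_eq (A : eqType) : bijrel (fun a b : A => a == b).
Proof. by apply: bijrel_graph; exists id. Qed.

Definition sumrel (A B A' B' : Type) (R : A -> A' -> bool)
    (S : B -> B' -> bool) (x : A + B) (y : A' + B') : bool :=
  match x, y with
  | inl a, inl a' => R a a'
  | inr b, inr b' => S b b'
  | _, _ => false
  end.

Lemma bijrel_sum (A B A' B' : Type) (R : A -> A' -> bool)
    (S : B -> B' -> bool) :
  bijrel R -> bijrel S -> bijrel (sumrel R S).
Proof.
case=> t s u i [t' s' u' i']; split.
- case=> [a|b]; first by case: (t a) => a' h; exists (inl a').
  by case: (t' b) => b' h; exists (inr b').
- case=> [a|b]; first by case: (s a) => a' h; exists (inl a').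
  by case: (s' b) => b' h; exists (inr b').
- move=> [a|a] [b|b] [b'|b'] //= h h'; first by rewrite (u _ _ _ h h').
  by rewrite (u' _ _ _ h h').
- move=> [a|a] [b|b] [b'|b'] //= h h'; first by rewrite (i _ _ _ h h').
  by rewrite (i' _ _ _ h h').
Qed.

Definition swap_sum (A B : Type) (x : A + B) : B + A :=
  match x with inl a => inr a | inr b => inl b end.

Definition sigrel (A B : Type) (R : A -> B -> bool) (P : pred A) (Q : pred B)
    (x : {a | P a}) (y : {b | Q b}) : bool := R (val x) (val y).

Lemma bijrel_sub (A B : Type) (R : A -> B -> bool) (P : pred A) (Q : pred B) :
  bijrel R -> (forall a b, R a b -> P a = Q b) -> bijrel (@sigrel _ _ R P Q).
Proof.
case=> t s u i PQ; split.
- case=> a Pa; case: (t a) => b h.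
  have Qb : Q b by rewrite -(PQ _ _ h).
  by exists (exist _ b Qb).
- case=> b Qb; case: (s b) => a h.
  have Pa : P a by rewrite (PQ _ _ h).
  by exists (exist _ a Pa).
- by move=> a b b' h h'; apply: val_inj; apply: u h h'.
- by move=> a a' b h h'; apply: val_inj; apply: i h h'.
Qed.

(** Applied to the edges of a [trim] in which nothing dangles, a subtype cut out by a predicate that
    always holds. *)
Lemma bijrel_subl (A B : Type) (R : A -> B -> bool) (P : pred A) :
  bijrel R -> (forall a, P a) ->
  bijrel (fun (x : {a | P a}) (b : B) => R (val x) b).
Proof.
case=> t s u i PT; split.
- by case=> a Pa; case: (t a) => b h; exists b.
- by move=> b; case: (s b) => a h; exists (exist _ a (PT a)).
- by move=> a b b' h h'; apply: u h h'.
- by move=> a a' b h h'; apply: val_inj; apply: i h h'.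
Qed.

Lemma bijrel_swap (A B C : Type) (R : A -> B + C -> bool) :
  bijrel R -> bijrel (fun (a : A) (x : C + B) => R a (swap_sum x)).
Proof.
case=> t s u i; split.
- by move=> a; case: (t a) => -[b|c] h; [exists (inr b)|exists (inl c)].
- by move=> x; case: (s (swap_sum x)) => a h; exists a.
- by move=> a [b|b] [b'|b'] h /(u _ _ _ h) //= [->].
- by move=> a a' b h h'; apply: i h h'.
Qed.

Definition relgiso (G H : mgraph) (RV : vert G -> vert H -> bool)
    (RE : edge G -> edge H -> bool) : Prop :=
  [/\ bijrel RV, bijrel RE,
      forall e e', RE e e' -> RV (src e) (src e')
    & forall e e', RE e e' -> RV (tgt e) (tgt e')].

Lemma relgiso_gisos (G H : mgraph) (RV : vert G -> vert H -> bool)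
    (RE : edge G -> edge H -> bool) : relgiso RV RE ->
  exists2 f, f \in gisos G H &
    (forall a b, RV a b = (f.1 a == b)) /\ (forall a b, RE a b = (f.2 a == b)).
Proof.
case=> /bijrel_fun[f fB fR] /bijrel_fun[g gB gR] hs ht.
exists (f, g); last by [].
apply/gisosP; split=> //= e; apply/eqP; rewrite -fR.
  by apply: hs; rewrite gR.
by apply: ht; rewrite gR.
Qed.

Lemma gisos_relgiso (G H : mgraph) f : f \in gisos G H ->
  relgiso (fun a b => f.1 a == b) (fun a b => f.2 a == b).
Proof.
case/gisosP=> f1 f2 hs ht; split; try exact: bijrel_graph.
  by move=> e e' /eqP <-; apply/eqP.
by move=> e e' /eqP <-; apply/eqP.
Qed.

Lemma relgiso_giso (G H : mgraph) (RV : vert G -> vert H -> bool)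
    (RE : edge G -> edge H -> bool) : relgiso RV RE -> giso G H.
Proof. by case/relgiso_gisos=> f hf _; apply/set0Pn; exists f. Qed.

Lemma gisoP (G H : mgraph) : reflect (exists f, f \in gisos G H) (giso G H).
Proof. exact: set0Pn. Qed.

Lemma giso_refl (G : mgraph) : giso G G.
Proof. by apply/gisoP; eexists; apply: gisos_id. Qed.

Lemma giso_sym (G H : mgraph) : giso G H -> giso H G.
Proof.
by case/gisoP=> f /gisos_inv[g hg _]; apply/gisoP; exists g.
Qed.

Lemma giso_trans (G H L : mgraph) : giso G H -> giso H L -> giso G L.
Proof.
case/gisoP=> f hf /gisoP[g hg]; apply/gisoP; eexists.
exact: gisos_comp hf hg.
Qed.

Lemma gsumC (G H : mgraph) : giso (gsum G H) (gsum H G).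
Proof.
apply: (@relgiso_giso (gsum G H) (gsum H G)
  (fun x y => sumrel (@eq_op _) (@eq_op _) x (swap_sum y))
  (fun x y => sumrel (@eq_op _) (@eq_op _) x (swap_sum y))); split.
- by apply: bijrel_swap; apply: bijrel_sum; apply: bijrel_eq.
- by apply: bijrel_swap; apply: bijrel_sum; apply: bijrel_eq.
- by move=> [e|e] [e'|e'] //= /eqP->.
- by move=> [e|e] [e'|e'] //= /eqP->.
Qed.

Lemma gsum_empty (G H : mgraph) : (vert G -> False) -> giso (gsum G H) H.
Proof.
move=> G0; have E0 (e : edge G) : False by apply: (G0 (src e)).
apply: (@relgiso_giso (gsum G H) H
   (fun x y => if x is inr z then z == y else false)
   (fun x y => if x is inr z then z == y else false)); split.
- split=> [[x|x]|y|[x|x] y y'|[x|x] [x'|x'] y] //=; try by case: (G0 x).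
  + by exists x.
  + by exists (inr y).
  + by move/eqP=> <- /eqP.
  + by move/eqP=> -> /eqP->.
- split=> [[x|x]|y|[x|x] y y'|[x|x] [x'|x'] y] //=; try by case: (E0 x).
  + by exists x.
  + by exists (inr y).
  + by move/eqP=> <- /eqP.
  + by move/eqP=> -> /eqP->.
- by move=> [e|e] e' //= /eqP->.
- by move=> [e|e] e' //= /eqP->.
Qed.

Lemma mem_img2 (A A' B B' : finType) (f : A -> A') (g : B -> B') r a b :
  injective f -> injective g -> ((f a, g b) \in img2 f g r) = ((a, b) \in r).
Proof.
move=> fI gI; apply/imsetP/idP => [[[x y] h [/fI-> /gI->]]//|h].
by exists (a, b).
Qed.

Lemma bijrel_img2 (A A' B B' : finType) (f : {ffun A -> A'})
    (g : {ffun B -> B'}) (r : {set A * B}) (r' : {set A' * B'}) :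
  bijective f -> bijective g ->
  (forall a a' b b', f a == a' -> g b == b' ->
     ((a, b) \in r) = ((a', b') \in r')) ->
  img2 f g r = r'.
Proof.
move=> fB gB h; apply/setP=> -[a' b'].
case: (fB) (gB) => f' _ f'K [g' _ g'K].
rewrite -(f'K a') -(g'K b') mem_img2; try exact: bij_inj.
by apply: h; apply/eqP.
Qed.

(** Since the four relations are bijective, comparing the rules on corresponding pairs determines
    the image of one rule in the other. *)
Lemma rule_isoI (r s : lrule) RV RE SV SE :
  @relgiso (inp r) (inp s) RV RE -> @relgiso (out r) (out s) SV SE ->
  (forall a a' b b', RV a a' -> SV b b' ->
     ((a, b) \in relV (lrel r)) = ((a', b') \in relV (lrel s))) ->
  (forall a a' b b', RE a a' -> SE b b' ->
     ((a, b) \in relE (lrel r)) = ((a', b') \in relE (lrel s))) ->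
  rule_iso r s.
Proof.
case/relgiso_gisos=> f hf [f1 f2] /relgiso_gisos[g hg [g1 g2]] hV hE.
apply/rule_isoP; exists f, g.
case/gisosP: (hf) (hg) => fb1 fb2 _ _ /gisosP[gb1 gb2 _ _].
split=> //; apply: bijrel_img2 => // a a' b b' ha hb.
  by apply: hV; rewrite ?f1 ?g1.
by apply: hE; rewrite ?f2 ?g2.
Qed.

Lemma rule_isoE (r s : lrule) : rule_iso r s -> exists f g,
  [/\ f \in gisos (inp r) (inp s), g \in gisos (out r) (out s),
      forall a b, ((a, b) \in relV (lrel r)) =
                  ((f.1 a, g.1 b) \in relV (lrel s))
    & forall a b, ((a, b) \in relE (lrel r)) =
                  ((f.2 a, g.2 b) \in relE (lrel s))].
Proof.
case/rule_isoP=> f [g [hf hg <- <-]]; exists f, g.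
case/gisosP: (hf) (hg) => fb1 fb2 _ _ /gisosP[gb1 gb2 _ _].
by split=> // a b; rewrite mem_img2 //; apply: bij_inj.
Qed.

Lemma pgm0E (G H : mgraph) :
  (forall p, (p \in relV (pgm0 G H)) = false) *
  (forall p, (p \in relE (pgm0 G H)) = false).
Proof. by split=> p; rewrite inE. Qed.

Lemma rule_iso_pgm0 (G G' H H' : mgraph) : giso G G' -> giso H H' ->
  rule_iso (LRule (pgm0 G H)) (LRule (pgm0 G' H')).
Proof.
case/gisoP=> f hf /gisoP[g hg].
apply: (rule_isoI (r := LRule _) (s := LRule _) (gisos_relgiso hf)
         (gisos_relgiso hg)) => a a' b b' _ _; by rewrite !pgm0E.
Qed.

Lemma pgm_idE (G : mgraph) :
  (forall u v, ((u, v) \in relV (pgm_id G)) = (u == v)) *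
  (forall u v, ((u, v) \in relE (pgm_id G)) = (u == v)).
Proof. by split=> u v; rewrite inE. Qed.

Lemma tilde_iso (G H : mgraph) :
  giso G H -> rule_iso (tilde_rule G) (tilde_rule H).
Proof.
case/gisoP=> f hf.
have /gisosP[f1 f2 _ _] := hf.
apply: (rule_isoI (r := tilde_rule _) (s := tilde_rule _) (gisos_relgiso hf)
         (gisos_relgiso hf)) => a a' b b' /= /eqP<- /eqP<-;
  by rewrite !pgm_idE bij_eq.
Qed.

Lemma breve_iso (G H : mgraph) :
  giso G H -> rule_iso (breve_rule G) (breve_rule H).
Proof. by move=> h; apply: rule_iso_pgm0. Qed.

Lemma rule_sum_iso (r r' s s' : lrule) : rule_iso r r' -> rule_iso s s' ->
  rule_iso (rule_sum r s) (rule_sum r' s').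
Proof.
case/rule_isoE=> f [g [/gisos_relgiso[f1 f2 f3 f4]]].
move=> /gisos_relgiso[g1 g2 g3 g4] hv he.
case/rule_isoE=> f' [g' [/gisos_relgiso[f1' f2' f3' f4']]].
move=> /gisos_relgiso[g1' g2' g3' g4'] hv' he'.
apply: (@rule_isoI (rule_sum r s) (rule_sum r' s')
  (sumrel _ _) (sumrel _ _) (sumrel _ _) (sumrel _ _)).
- split.
  + exact: bijrel_sum f1 f1'.
  + exact: bijrel_sum f2 f2'.
  + by move=> [e|e] [e'|e'] //= h; [apply: f3|apply: f3'].
  + by move=> [e|e] [e'|e'] //= h; [apply: f4|apply: f4'].
- split.
  + exact: bijrel_sum g1 g1'.
  + exact: bijrel_sum g2 g2'.
  + by move=> [e|e] [e'|e'] //= h; [apply: g3|apply: g3'].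
  + by move=> [e|e] [e'|e'] //= h; [apply: g4|apply: g4'].
- by move=> [a|a] [a'|a'] //= [b|b] [b'|b'] //= /eqP<- /eqP<-; rewrite !inE.
- by move=> [a|a] [a'|a'] //= [b|b] [b'|b'] //= /eqP<- /eqP<-; rewrite !inE.
Qed.

(** * Invariance of composites under isomorphism of rules *)

Definition orel (A B : Type) (R : A -> B -> bool) (x : option A)
    (y : option B) : bool :=
  match x, y with
  | Some a, Some b => R a b
  | None, None => true
  | _, _ => false
  end.

(** Redirected endpoints are accessible only through equations with [Some x]. If these equations
    agree along a bijection, the options correspond, including the case where both are [None]. *)
Lemma orelI (A B : eqType) (R : A -> B -> bool) (x : option A) (y : option B) :
  bijrel R -> (forall a b, R a b -> (x == Some a) = (y == Some b)) ->
  orel R x y.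
Proof.
case=> t s u i h; case: x y h => [a|] [b|] //= h.
- by case: (t a) => b' r; have := h _ _ r; rewrite eqxx => /esym/eqP[->].
- by case: (t a) => b' r; have := h _ _ r; rewrite eqxx.
- by case: (s b) => a' r; have := h _ _ r; rewrite eqxx.
Qed.

Definition preiso (P Q : pregraph) (RV : pvert P -> pvert Q -> bool)
    (RE : pedge P -> pedge Q -> bool) : Prop :=
  [/\ bijrel RV, bijrel RE,
      forall e e', RE e e' -> orel RV (psrc e) (psrc e')
    & forall e e', RE e e' -> orel RV (ptgt e) (ptgt e')].

Section PreIso.
Variables (P Q : pregraph) (RV : pvert P -> pvert Q -> bool).
Variables (RE : pedge P -> pedge Q -> bool).
Hypothesis h : preiso RV RE.

Lemma preiso_dangling e e' : RE e e' -> dangling e = dangling e'.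
Proof.
case: h => _ _ hs ht r; move: (hs _ _ r) (ht _ _ r); rewrite /dangling.
by case: (psrc e) (psrc e') (ptgt e) (ptgt e') => [?|] [?|] // [?|] [?|].
Qed.

Lemma preiso_has_dangling : has_dangling P = has_dangling Q.
Proof.
case: (h) => _ [t s _ _] _ _; apply/existsP/existsP => -[e he].
  by case: (t e) => e' r; exists e'; rewrite -(preiso_dangling r).
by case: (s e) => e' r; exists e'; rewrite (preiso_dangling r).
Qed.

Lemma preiso_trim : @relgiso (trim P) (trim Q) RV (@sigrel _ _ RE _ _).
Proof.
case: (h) => hV hE hs ht; split=> //.
- by apply: bijrel_sub => // a b /preiso_dangling->.
- move=> [e he] [e' he'] r /=; move: (trim_src _) (trim_src _) (hs _ _ r) => /=.
  by case: (psrc e) (psrc e') => [?|] // [?|].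
- move=> [e he] [e' he'] r /=; move: (trim_tgt _) (trim_tgt _) (ht _ _ r) => /=.
  by case: (ptgt e) (ptgt e') => [?|] // [?|].
Qed.

End PreIso.

(* The common shape of both interfaces of a composite: [A] together with the
   part of [B] that remains, where [en] redirects the endpoints in [B]. *)
Definition half_comp (A B : mgraph) (PV : pred (vert B)) (PE : pred (edge B))
    (en : vert B -> option (vert A + {v : vert B | PV v})%type) : pregraph :=
  @PreGraph (vert A + {v : vert B | PV v})%type
    (edge A + {e : edge B | PE e})%type
    (fun e => match e with
              | inl x => Some (inl (src x))
              | inr y => en (src (val y))
              end)
    (fun e => match e with
              | inl x => Some (inl (tgt x))
              | inr y => en (tgt (val y))
              end).

(** Both [comp_inp] and [comp_out] are instances of [half_comp] up to conversion, so this compares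
    either kind of interface. *)
Lemma half_preiso (A B A' B' : mgraph) (PV : pred (vert B)) (PE : pred (edge B))
    (PV' : pred (vert B')) (PE' : pred (edge B')) en en' RV RE SV SE :
  @relgiso A A' RV RE -> @relgiso B B' SV SE ->
  (forall v v', SV v v' -> PV v = PV' v') ->
  (forall e e', SE e e' -> PE e = PE' e') ->
  (forall v v' x x', SV v v' -> sumrel RV (@sigrel _ _ SV PV PV') x x' ->
     (en v == Some x) = (en' v' == Some x')) ->
  @preiso (@half_comp A B PV PE en) (@half_comp A' B' PV' PE' en')
    (sumrel RV (@sigrel _ _ SV PV PV')) (sumrel RE (@sigrel _ _ SE PE PE')).
Proof.
move=> [hV hE hs ht] [kV kE ks kt] pV pE hen.
have bV : bijrel (sumrel RV (@sigrel _ _ SV PV PV')).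
  by apply: bijrel_sum => //; apply: bijrel_sub.
split=> //.
- by apply: bijrel_sum => //; apply: bijrel_sub.
- move=> [e|e] [e'|e'] //= r; first exact: hs.
  by apply: orelI => // x x' hx; apply: hen => //; apply: ks.
- move=> [e|e] [e'|e'] //= r; first exact: ht.
  by apply: orelI => // x x' hx; apply: hen => //; apply: kt.
Qed.

Section Ends.
Variables I1 O1 I2 O2 : mgraph.
Variables (r1 : pgm I1 O1) (r2 : pgm I2 O2) (m : pgm O2 I1).

(** The relations being one-to-one, the vertex found by [pick] is the only candidate, so the
    endpoint is characterised without reference to a choice. *)
Lemma inp_endE v x : (inp_end r2 m v == Some x) =
  match x with
  | inl w => (w, v) \in rcomp (relV m) (relV r2)
  | inr u => val u == v
  end.
Proof.
have /one_to_oneP[_ c] := rcomp_inj (relV_inj m) (relV_inj r2).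
rewrite /inp_end; case: insubP => [u uP uv|vP].
  case: x => [w|u']; apply/eqP/idP => //.
  - case/rcompP=> y _ h; case/negP: uP; apply/imsetP; exists (y, v) => //.
  - by case=> <-; rewrite uv.
  - by move/eqP=> e; congr (Some (inr _)); apply: val_inj; rewrite uv.
have nv (u' : {x0 | x0 \notin rim (relV m)}) : val u' == v = false.
  by apply/eqP=> e; case/negP: vP; rewrite -e (valP u').
case: pickP => [w hw|h] /=; case: x => [w'|u'].
- by apply/eqP/idP => [[<-]//|h']; rewrite (c _ _ _ hw h').
- by rewrite nv.
- by rewrite h.
- by rewrite nv.
Qed.

Lemma out_endE v x : (out_end r1 m v == Some x) =
  match x with
  | inl w => (v, w) \in rcomp (relV r1) (relV m)
  | inr u => val u == v
  end.
Proof.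
have /one_to_oneP[c _] := rcomp_inj (relV_inj r1) (relV_inj m).
rewrite /out_end; case: insubP => [u uP uv|vP].
  case: x => [w|u']; apply/eqP/idP => //.
  - case/rcompP=> y h _; case/negP: uP; apply/imsetP; exists (v, y) => //.
  - by case=> <-; rewrite uv.
  - by move/eqP=> e; congr (Some (inr _)); apply: val_inj; rewrite uv.
have nv (u' : {x0 | x0 \notin rdom (relV m)}) : val u' == v = false.
  by apply/eqP=> e; case/negP: vP; rewrite -e (valP u').
case: pickP => [w hw|h] /=; case: x => [w'|u'].
- by apply/eqP/idP => [[<-]//|h']; rewrite (c _ _ _ hw h').
- by rewrite nv.
- by rewrite h.
- by rewrite nv.
Qed.

End Ends.

Lemma rdomP (A B : finType) (r : {set A * B}) a :
  reflect (exists b, (a, b) \in r) (a \in rdom r).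
Proof.
apply: (iffP imsetP) => [[[x y] h ->]|[b h]]; first by exists y.
by exists (a, b).
Qed.

Lemma rimP (A B : finType) (r : {set A * B}) b :
  reflect (exists a, (a, b) \in r) (b \in rim r).
Proof.
apply: (iffP imsetP) => [[[x y] h ->]|[a h]]; first by exists x.
by exists (a, b).
Qed.

Section RelInvariance.
Variables A B C A' B' C' : finType.
Variables (f : A -> A') (g : B -> B') (h : C -> C').
Hypotheses (fB : bijective f) (gB : bijective g) (hB : bijective h).
Variables (r : {set A * B}) (r' : {set A' * B'}).
Variables (s : {set B * C}) (s' : {set B' * C'}).
Hypothesis rr' : forall a b, ((a, b) \in r) = ((f a, g b) \in r').
Hypothesis ss' : forall b c, ((b, c) \in s) = ((g b, h c) \in s').

Lemma rdom_inv a : (a \in rdom r) = (f a \in rdom r').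
Proof.
apply/rdomP/rdomP => -[b]; first by rewrite rr'; exists (g b).
by case: gB => g' gK g'K; exists (g' b); rewrite rr' g'K.
Qed.

Lemma rim_inv b : (b \in rim r) = (g b \in rim r').
Proof.
apply/rimP/rimP => -[a]; first by rewrite rr'; exists (f a).
by case: fB => f' fK f'K; exists (f' a); rewrite rr' f'K.
Qed.

Lemma rcomp_inv a c :
  ((a, c) \in rcomp s r) = ((f a, h c) \in rcomp s' r').
Proof.
apply/rcompP/rcompP => -[b]; rewrite ?rr' ?ss'; first by exists (g b).
case: gB => g' gK g'K h1 h2.
by exists (g' b); rewrite ?rr' ?ss' g'K.
Qed.

End RelInvariance.

Section Transport.
Variables (G G' H H' : mgraph).
Variables (f : {ffun vert G -> vert G'} * {ffun edge G -> edge G'}).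
Variables (g : {ffun vert H -> vert H'} * {ffun edge H -> edge H'}).
Hypotheses (hf : f \in gisos G G') (hg : g \in gisos H H').

Fact transport_ok (m : pgm G H) :
  @pgm_ok G' H' (img2 f.1 g.1 (relV m), img2 f.2 g.2 (relE m)).
Proof.
case/gisosP: (hf) (hg) => f1 f2 f3 f4 /gisosP[g1 g2 g3 g4]; apply: pgm_okI.
- by rewrite img2_inj ?relV_inj //; apply: bij_inj.
- by rewrite img2_inj ?relE_inj //; apply: bij_inj.
move=> e e' /imsetP[[x y] h [-> ->]] /=; rewrite -f3 -f4 -g3 -g4.
split; apply/imsetP.
  by exists (src x, src y) => //; apply: relE_src.
by exists (tgt x, tgt y) => //; apply: relE_tgt.
Qed.

Definition transport (m : pgm G H) : pgm G' H' := Pgm (transport_ok m).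

Lemma transportV m a b :
  ((a, b) \in relV m) = ((f.1 a, g.1 b) \in relV (transport m)).
Proof.
case/gisosP: (hf) (hg) => f1 f2 f3 f4 /gisosP[g1 g2 g3 g4].
by rewrite mem_img2 //; apply: bij_inj.
Qed.

Lemma transportE m a b :
  ((a, b) \in relE m) = ((f.2 a, g.2 b) \in relE (transport m)).
Proof.
case/gisosP: (hf) (hg) => f1 f2 f3 f4 /gisosP[g1 g2 g3 g4].
by rewrite mem_img2 //; apply: bij_inj.
Qed.

End Transport.

Lemma pgm_eq (G H : mgraph) (m n : pgm G H) :
  relV m = relV n -> relE m = relE n -> m = n.
Proof.
move=> h1 h2; apply: val_inj => /=.
by rewrite [LHS]surjective_pairing [RHS]surjective_pairing; congr pair.
Qed.

(** Transporting back along the inverse isomorphisms is the inverse; this permits reindexing a sum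
    over matches. *)
Lemma transport_bij (G G' H H' : mgraph) f g (hf : f \in gisos G G')
  (hg : g \in gisos H H') : bijective (transport hf hg).
Proof.
have [f' hf' [f1 f2]] := gisos_inv hf; have [g' hg' [g1 g2]] := gisos_inv hg.
case/gisosP: (hf) => fb1 fb2 _ _; case/gisosP: (hg) => gb1 gb2 _ _.
exists (transport hf' hg') => m; apply: pgm_eq;
  rewrite /relV /relE /= img2_comp.
- by apply: img2_id.
- by apply: img2_id.
- by apply: img2_id; [exact: ((bij_can_sym fb1 _).2 f1)
                      |exact: ((bij_can_sym gb1 _).2 g1)].
- by apply: img2_id; [exact: ((bij_can_sym fb2 _).2 f2)
                      |exact: ((bij_can_sym gb2 _).2 g2)].
Qed.

Section CompInvariance.
Variables (r r' s s' : lrule).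
Variables (f : {ffun vert (inp r) -> vert (inp r')} *
               {ffun edge (inp r) -> edge (inp r')}).
Variables (g : {ffun vert (out r) -> vert (out r')} *
               {ffun edge (out r) -> edge (out r')}).
Variables (k : {ffun vert (inp s) -> vert (inp s')} *
               {ffun edge (inp s) -> edge (inp s')}).
Variables (l : {ffun vert (out s) -> vert (out s')} *
               {ffun edge (out s) -> edge (out s')}).
Hypothesis hf : f \in gisos (inp r) (inp r').
Hypothesis hg : g \in gisos (out r) (out r').
Hypothesis hk : k \in gisos (inp s) (inp s').
Hypothesis hl : l \in gisos (out s) (out s').
Hypothesis rV : forall a b,
  ((a, b) \in relV (lrel r)) = ((f.1 a, g.1 b) \in relV (lrel r')).
Hypothesis rE : forall a b,
  ((a, b) \in relE (lrel r)) = ((f.2 a, g.2 b) \in relE (lrel r')).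
Hypothesis sV : forall a b,
  ((a, b) \in relV (lrel s)) = ((k.1 a, l.1 b) \in relV (lrel s')).
Hypothesis sE : forall a b,
  ((a, b) \in relE (lrel s)) = ((k.2 a, l.2 b) \in relE (lrel s')).
Variable m : pgm (out s) (inp r).
Let m' : pgm (out s') (inp r') := transport hl hf m.

Let mV : forall a b, ((a, b) \in relV m) = ((l.1 a, f.1 b) \in relV m').
Proof. exact: transportV. Qed.

Let mE : forall a b, ((a, b) \in relE m) = ((l.2 a, f.2 b) \in relE m').
Proof. exact: transportE. Qed.

Lemma comp_inp_preiso :
  @preiso (comp_inp (lrel s) m) (comp_inp (lrel s') m')
    (sumrel (fun a b => k.1 a == b) (@sigrel _ _ (fun a b => f.1 a == b) _ _))
    (sumrel (fun a b => k.2 a == b) (@sigrel _ _ (fun a b => f.2 a == b) _ _)).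
Proof.
case/gisosP: (hl) => l1 l2 _ _; case/gisosP: (hf) => f1 f2 _ _.
apply: half_preiso; try exact: gisos_relgiso.
- by move=> v _ /eqP<-; rewrite (rim_inv l1 mV).
- by move=> v _ /eqP<-; rewrite (rim_inv l2 mE).
move=> v _ x x' /eqP<-; rewrite !inp_endE.
case: x x' => [x|x] [x'|x'] //=.
  by move/eqP<-; rewrite (rcomp_inv l1 sV mV).
by rewrite /sigrel => /eqP<-; rewrite bij_eq.
Qed.

Lemma comp_out_preiso :
  @preiso (comp_out (lrel r) m) (comp_out (lrel r') m')
    (sumrel (fun a b => g.1 a == b) (@sigrel _ _ (fun a b => l.1 a == b) _ _))
    (sumrel (fun a b => g.2 a == b) (@sigrel _ _ (fun a b => l.2 a == b) _ _)).
Proof.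
case/gisosP: (hl) => l1 l2 _ _; case/gisosP: (hf) => f1 f2 _ _.
apply: half_preiso; try exact: gisos_relgiso.
- by move=> v _ /eqP<-; rewrite (rdom_inv f1 mV).
- by move=> v _ /eqP<-; rewrite (rdom_inv f2 mE).
move=> v _ x x' /eqP<-; rewrite !out_endE.
case: x x' => [x|x] [x'|x'] //=.
  by move/eqP<-; rewrite (rcomp_inv f1 mV rV).
by rewrite /sigrel => /eqP<-; rewrite bij_eq.
Qed.

(** The isomorphisms of the four given interfaces assemble to isomorphisms of the two new ones,
    under which the three kinds of pairs in a glued relation correspond: composed through the match,
    kept from [s], kept from [r]. *)
Lemma comp_rule_iso :
  rule_iso (comp_rule (lrel r) (lrel s) m) (comp_rule (lrel r') (lrel s') m').
Proof.
have /gisosP[l1 l2 _ _] := hl; have /gisosP[f1 f2 _ _] := hf.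
have E (A B : Type) (P : pred A) (Q : pred B) (R : A -> B -> bool) x y :
  @sigrel A B R P Q x y = R (val x) (val y) by [].
apply: (@rule_isoI (comp_rule (lrel r) (lrel s) m)
  (comp_rule (lrel r') (lrel s') m') _ _ _ _
  (preiso_trim comp_inp_preiso) (preiso_trim comp_out_preiso)).
  move=> a a' b b' /= ha hb; rewrite !in_glue_rel.
  move: a a' b b' ha hb => [a|a] [a'|a'] // [b|b] [b'|b'] //=; rewrite ?E.
  - by move=> /eqP<- /eqP<-; apply: (rcomp_inv f1) => //; apply: (rcomp_inv l1).
  - by move=> /eqP<- /eqP<-.
  - by move=> /eqP<- /eqP<-.
move=> [a ha] [a' ha'] [b hb] [b' hb'] /=.
rewrite !E ![_ \in comp_relE _ _ _]in_set.
rewrite !in_glue_rel /=.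
move: a a' b b' {ha ha' hb hb'} => [a|a] [a'|a'] // [b|b] [b'|b'] //=;
  rewrite ?E.
- by move=> /eqP<- /eqP<-; apply: (rcomp_inv f2) => //; apply: (rcomp_inv l2).
- by move=> /eqP<- /eqP<-.
- by move=> /eqP<- /eqP<-.
Qed.

End CompInvariance.

(** * Products of basis elements *)

Lemma sum_msuppU (K : fieldType) (C : choiceType) (V : lmodType K) (a b : C)
    (F : C -> C -> V) :
  \sum_(c <- msupp (<< a >> : {malg K[C]}))
    \sum_(d <- msupp (<< b >> : {malg K[C]}))
      ((<< a >> : {malg K[C]})@_c * (<< b >> : {malg K[C]})@_d) *: F c d =
  F a b.
Proof.
have S x : msupp (<< x >> : {malg K[C]}) = [fset x]%fset.
  by rewrite msuppU oner_eq0.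
by rewrite !S !big_seq_fset1 !mcoeffUU mulr1 scale1r.
Qed.

Lemma delta_eq (K : fieldType) (r s : lrule) :
  rule_iso r s -> delta K r = delta K s.
Proof. by rewrite -class_ofP /delta => /eqP->. Qed.

Lemma rep_iso (r : lrule) : rule_iso (rep (class_of r)) r.
Proof. by rewrite -class_ofP repK. Qed.

Section Bilin.
Variables (K : fieldType) (f : lrule -> lrule -> ralg K).
Implicit Types x y z : ralg K.

(** The supports of [x], [y] and [a *: x + y] differ in general; over a common finite set containing
    them, linearity can be checked term by term. *)
Lemma bilinEw (d1 d2 : {fset rclass}) x y :
  (msupp x `<=` d1)%fset -> (msupp y `<=` d2)%fset ->
  bilin f x y = \sum_(c <- d1) \sum_(d <- d2)
     (x@_c * y@_d) *: f (rep c) (rep d).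
Proof.
move=> h1 h2; rewrite /bilin (big_fset_incl _ h1) /= => [|c _ hc].
  apply: eq_bigr => c _; rewrite (big_fset_incl _ h2) //= => d _ hd.
  by rewrite (mcoeff_outdom hd) mulr0 scale0r.
by apply: big1 => d _; rewrite (mcoeff_outdom hc) mul0r scale0r.
Qed.

Lemma bilinDl a x y z :
  bilin f (a *: x + y) z = a *: bilin f x z + bilin f y z.
Proof.
pose d1 := (msupp x `|` msupp y `|` msupp (a *: x + y))%fset.
have s1 : (msupp (a *: x + y) `<=` d1)%fset by rewrite fsubsetUr.
have s2 : (msupp x `<=` d1)%fset by rewrite /d1 -fsetUA fsubsetUl.
have s3 : (msupp y `<=` d1)%fset.
  by rewrite /d1 -fsetUA fsetUC -fsetUA fsubsetUl.
rewrite (bilinEw s1 (fsubset_refl _)) (bilinEw s2 (fsubset_refl _)).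
rewrite (bilinEw s3 (fsubset_refl _)) scaler_sumr -big_split /=.
apply: eq_bigr => c _; rewrite scaler_sumr -big_split /=.
apply: eq_bigr => d _; rewrite mcoeffD mcoeffZ mulrDl scalerDl.
by rewrite scalerA mulrA.
Qed.

Lemma bilinDr a x y z :
  bilin f z (a *: x + y) = a *: bilin f z x + bilin f z y.
Proof.
pose d1 := (msupp x `|` msupp y `|` msupp (a *: x + y))%fset.
have s1 : (msupp (a *: x + y) `<=` d1)%fset by rewrite fsubsetUr.
have s2 : (msupp x `<=` d1)%fset by rewrite /d1 -fsetUA fsubsetUl.
have s3 : (msupp y `<=` d1)%fset.
  by rewrite /d1 -fsetUA fsetUC -fsetUA fsubsetUl.
rewrite (bilinEw (fsubset_refl _) s1) (bilinEw (fsubset_refl _) s2).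
rewrite (bilinEw (fsubset_refl _) s3) scaler_sumr -big_split /=.
apply: eq_bigr => c _; rewrite scaler_sumr -big_split /=.
apply: eq_bigr => d _; rewrite mcoeffD mcoeffZ mulrDr scalerDl.
by rewrite scalerA mulrCA.
Qed.

Lemma bilin0l z : bilin f 0 z = 0.
Proof. by rewrite /bilin msupp0 big_nil. Qed.

Lemma bilin0r z : bilin f z 0 = 0.
Proof.
by rewrite /bilin; apply: big1 => c _; rewrite msupp0 big_nil.
Qed.

Lemma bilin_delta r s :
  bilin f (delta K r) (delta K s) =
  f (rep (class_of r)) (rep (class_of s)).
Proof.
exact: (sum_msuppU _ _ (fun c d => f (rep c) (rep d))).
Qed.

End Bilin.

Lemma superpose_delta (K : fieldType) (r s : lrule) :
  superpose (delta K r) (delta K s) = delta K (rule_sum r s).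
Proof.
by rewrite /superpose bilin_delta; apply: delta_eq; apply: rule_sum_iso;
  apply: rep_iso.
Qed.

(** [bilin] evaluates on chosen representatives. The isomorphisms from these to [r] and [s]
    transport matches bijectively and respect both danglingness and the composite, so the choice has
    no effect. *)
Lemma rmul_delta (K : fieldType) (T : rtype) (r s : lrule) :
  rmul T (delta K r) (delta K s) =
  \sum_(m : pgm (out s) (inp r)) oapp (delta K) 0 (reduct T m).
Proof.
rewrite /rmul bilin_delta; move: (rep_iso r) (rep_iso s).
move: (rep _) (rep _) => r' s'.
case/rule_isoE=> f [g [hf hg rV rE]] /rule_isoE[k [l [hk hl sV sE]]].
rewrite [RHS](reindex (transport hl hf)) /=; last first.
  by apply: onW_bij; apply: transport_bij.
apply: eq_bigr => m _; rewrite /reduct.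
rewrite (preiso_has_dangling (comp_inp_preiso hf hk hl sV m)).
rewrite (preiso_has_dangling (comp_out_preiso hf hg hl rV m)).
case: ifP => _ /=; first by [].
exact: (delta_eq K (comp_rule_iso hf hg hk hl rV rE sV sE m)).
Qed.

(** * The contribution of the trivial match *)

Section TrivialMatch.
Variables r s : lrule.
Let m := pgm0 (out s) (inp r).

Lemma rdom0 (A B : finType) x : (x \in rdom (set0 : {set A * B})) = false.
Proof. by apply/rdomP => -[y]; rewrite inE. Qed.

Lemma rim0 (A B : finType) x : (x \in rim (set0 : {set A * B})) = false.
Proof. by apply/rimP => -[y]; rewrite inE. Qed.

Lemma inp_end0 v x :
  (inp_end (lrel s) m v == Some x) = (if x is inr u then val u == v else false).
Proof.
rewrite inp_endE; case: x => // w.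
by apply/rcompP => -[y _]; rewrite pgm0E.
Qed.

Lemma out_end0 v x :
  (out_end (lrel r) m v == Some x) = (if x is inr u then val u == v else false).
Proof.
rewrite out_endE; case: x => // w.
by apply/rcompP => -[y]; rewrite pgm0E.
Qed.


End TrivialMatch.

Lemma relgiso_swap (G A B : mgraph) RV RE :
  @relgiso G (gsum A B) RV RE ->
  @relgiso G (gsum B A) (fun x y => RV x (swap_sum y))
    (fun x y => RE x (swap_sum y)).
Proof.
case=> hV hE hs ht; split; try exact: bijrel_swap.
- by move=> e [e'|e'] /hs.
- by move=> e [e'|e'] /ht.
Qed.

Lemma bijrel_id (A : eqType) (P : pred A) : (forall a, P a) ->
  bijrel (fun (x : {a | P a}) (b : A) => val x == b).
Proof. by apply: (bijrel_subl (R := fun a b => a == b)); apply: bijrel_eq. Qed.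

Section HalfTrivial.
Variables (A B : mgraph) (PV : pred (vert B)) (PE : pred (edge B)).
Variable en : vert B -> option (vert A + {v : vert B | PV v})%type.
Hypotheses (PVT : forall v, PV v) (PET : forall e, PE e).
Hypothesis enE : forall v x,
  (en v == Some x) = (if x is inr u then val u == v else false).

Let en_some v : exists2 u, en v = Some (inr u) & val u = v.
Proof.
exists (exist _ v (PVT v)) => //.
by apply/eqP; rewrite enE.
Qed.

(** Nothing of [B] is removed, so every endpoint survives as its own copy in the right summand. *)
Lemma half_trivial_dangling e : ~~ @dangling (half_comp PE en) e.
Proof.
rewrite negbK; case: e => [e|[e he]] //=.
by case: (en_some (src e)) (en_some (tgt e)) => [u -> _] [w -> _].
Qed.

Lemma half_trivial_relgiso :
  @relgiso (trim (half_comp PE en)) (gsum A B)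
    (sumrel (@eq_op _) (fun u b => val u == b))
    (fun x => sumrel (@eq_op _) (fun u b => val u == b) (val x)).
Proof.
have hV : bijrel (sumrel (@eq_op (vert A))
    (fun (u : {v | PV v}) b => val u == b)).
  by apply: bijrel_sum; [apply: bijrel_eq|apply: bijrel_id].
have hE : bijrel (sumrel (@eq_op (edge A))
    (fun (u : {e | PE e}) b => val u == b)).
  by apply: bijrel_sum; [apply: bijrel_eq|apply: bijrel_id].
split=> //.
- exact: (bijrel_subl hE half_trivial_dangling).
- move=> [[e|[e he]] he'] [e'|e'] //= /eqP <- //=.
  move: (trim_src _) => /=.
  by case: (en_some (src e)) => u /= -> /= <-.
- move=> [[e|[e he]] he'] [e'|e'] //= /eqP <- //=.
  move: (trim_tgt _) => /=.
  by case: (en_some (tgt e)) => u /= -> /= <-.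
Qed.

End HalfTrivial.

Section TrivialComposite.
Variables r s : lrule.
Let m := pgm0 (out s) (inp r).

Let inp_trivV v : v \notin rim (relV m). Proof. by rewrite rim0. Qed.
Let inp_trivE e : e \notin rim (relE m). Proof. by rewrite rim0. Qed.
Let out_trivV v : v \notin rdom (relV m). Proof. by rewrite rdom0. Qed.
Let out_trivE e : e \notin rdom (relE m). Proof. by rewrite rdom0. Qed.

Lemma comp0_has_dangling :
  has_dangling (comp_inp (lrel s) m) || has_dangling (comp_out (lrel r) m)
  = false.
Proof.
apply/norP; split; apply/existsPn => e.
  exact: (half_trivial_dangling inp_trivV (@inp_end0 r s)).
exact: (half_trivial_dangling out_trivV (@out_end0 r s)).
Qed.

Lemma comp0_iso : rule_iso (comp_rule (lrel r) (lrel s) m) (rule_sum r s).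
Proof.
(* The input interface of the composite lists [inp s] first, that of [rule_sum r s] lists [inp r]
   first; hence the swap on the input side only. *)
apply: (@rule_isoI (comp_rule (lrel r) (lrel s) m) (rule_sum r s) _ _ _ _
  (relgiso_swap (half_trivial_relgiso inp_trivV inp_trivE (@inp_end0 r s)))
  (half_trivial_relgiso out_trivV out_trivE (@out_end0 r s))).
  move=> a a' b b' /= ha hb; rewrite in_glue_rel inE.
  move: a a' b b' ha hb => [a|a] [a'|a'] // [b|b] [b'|b'] //=.
  - by move=> _ _; apply/rcompP => -[x /rcompP[y _]]; rewrite pgm0E.
  - by move=> /eqP<- /eqP<-.
  - by move=> /eqP<- /eqP<-.
move=> [a ha] a' [b hb] b' /=; rewrite ![_ \in comp_relE _ _ _]in_set.
rewrite in_glue_rel inE /=.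
move: a a' b b' {ha hb} => [a|a] [a'|a'] // [b|b] [b'|b'] //=.
- by move=> _ _; apply/rcompP => -[x /rcompP[y _]]; rewrite pgm0E.
- by move=> /eqP<- /eqP<-.
- by move=> /eqP<- /eqP<-.
Qed.

Lemma reduct0 (K : fieldType) (T : rtype) :
  oapp (delta K) 0 (reduct T m) = delta K (rule_sum r s).
Proof.
have /norP[/negbTE h1 /negbTE h2] := negbT comp0_has_dangling.
rewrite /reduct h1 h2 !andbF /=; apply: delta_eq; exact: comp0_iso.
Qed.

End TrivialComposite.

(** The term of the empty match equals the superposition and cancels, and the terms whose reduct is
    zero drop out. *)
Lemma nontriv_delta (K : fieldType) (T : rtype) (r s : lrule) :
  nontriv_mul T (delta K r) (delta K s) =
  \sum_(m : pgm (out s) (inp r) | contributes T m)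
     delta K (comp_rule (lrel r) (lrel s) m).
Proof.
rewrite /nontriv_mul rmul_delta superpose_delta (bigD1 (pgm0 _ _)) //=.
rewrite reduct0 [LHS]addrC addKr [RHS]big_mkcondr /=; apply: eq_bigr => m _.
by rewrite /reduct; case: ifP.
Qed.

(** * Composites of identity rules *)

(* [A] with the unmatched part of [B], versus [B] with the unmatched part of
   [A]. *)
Definition ovrel (A B : finType) (m : {set A * B}) (P : pred B) (Q : pred A)
    (x : A + {b | P b}) (y : B + {a | Q a}) : bool :=
  match x, y with
  | inl a, inl b => (a, b) \in m
  | inl a, inr a' => a == val a'
  | inr b, inl b' => val b == b'
  | inr _, inr _ => false
  end.

(** A matched element corresponds to its partner and an unmatched one to its own copy. [P] and [Q]
    are fixed only up to pointwise equality, so that the same relation also serves for the converse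
    of a match, whose domain is an image. *)
Lemma bijrel_ov (A B : finType) (m : {set A * B}) (P : pred B) (Q : pred A) :
  one_to_one m -> (forall b, P b = (b \notin rim m)) ->
  (forall a, Q a = (a \notin rdom m)) -> bijrel (@ovrel A B m P Q).
Proof.
case/one_to_oneP=> u i hP hQ.
have dQ (a : {a | Q a}) b : ((val a, b) \in m) = false.
  apply/negP=> h; move: (valP a); rewrite hQ => /negP; apply.
  by apply/rdomP; exists b.
have iP (b : {b | P b}) a : ((a, val b) \in m) = false.
  apply/negP=> h; move: (valP b); rewrite hP => /negP; apply.
  by apply/rimP; exists a.
split.
- move=> [a|b]; last by exists (inl (val b)) => /=.
  have [/rdomP[b h]|h] := boolP (a \in rdom m); first by exists (inl b).
  by have h' : Q a; [rewrite hQ|exists (inr (exist _ a h')) => /=].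
- move=> [b|a]; last by exists (inl (val a)) => /=.
  have [/rimP[a h]|h] := boolP (b \in rim m); first by exists (inl a).
  by have h' : P b; [rewrite hP|exists (inr (exist _ b h')) => /=].
- move=> [a|b] [b1|a1] [b2|a2] //=.
  + by move=> h1 h2; rewrite (u _ _ _ h1 h2).
  + by move=> h /eqP e; rewrite e dQ in h.
  + by move=> /eqP e h; rewrite e dQ in h.
  + by move=> /eqP-> /eqP/val_inj->.
  + by move=> /eqP-> /eqP->.
- move=> [a1|b1] [a2|b2] [b|a] //=.
  + by move=> h1 h2; rewrite (i _ _ _ h1 h2).
  + by move=> /eqP-> /eqP->.
  + by move=> h /eqP e; rewrite -e iP in h.
  + by move=> /eqP e h; rewrite -e iP in h.
  + by move=> /eqP<- /eqP/val_inj->.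
Qed.

Lemma overlap_vertE (O1 O2 : mgraph) (m : pgm O2 O1) v x :
  (overlap_vert m v == x) =
  match x with inl b => (v, b) \in relV m | inr u => val u == v end.
Proof.
have /one_to_oneP[c _] := relV_inj m.
rewrite /overlap_vert.
(* The match on [boolP] is dependent; generalising its scrutinee together with its boolean index
   makes the case analysis well typed. *)
have gen b (a : alt_spec (v \in rdom (relV m)) (v \in rdom (relV m)) b) :
    ((match a with
      | AltTrue h => inl (xchoose (rdom_ex h))
      | AltFalse h => inr (exist (fun u => u \notin rdom (relV m)) v h)
      end : vert O1 + {u | u \notin rdom (relV m)}) == x) =
    match x with inl b => (v, b) \in relV m | inr u => val u == v end.
  move: a; case=> h.
    have hc := xchooseP (rdom_ex h); case: x => [b'|u].
      by apply/eqP/idP => [[<-]//|hb]; rewrite (c _ _ _ hc hb).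
    by apply/eqP/eqP => // e; case/negP: (valP u); rewrite e.
  case: x => [b'|u].
    by apply/eqP/idP => // hb; case/negP: h; apply/rdomP; exists b'.
  apply/eqP/eqP => [[<-]//|e]; congr inr; exact: val_inj.
exact: gen.
Qed.

Lemma overlap_vert_ovrel (O1 O2 : mgraph) (m : pgm O2 O1) v :
  ovrel (relV m) (inl v : _ + {b | b \notin rim (relV m)}) (overlap_vert m v).
Proof.
have := overlap_vertE v (overlap_vert m v); rewrite eqxx.
by case: (overlap_vert m v) => [b|u] /= => [<-|/esym/eqP<-].
Qed.

(** Common to [tilde] and [breve] rules: redirecting an endpoint through such a relation yields the
    matched vertex itself or nothing. *)
Definition subid (G : mgraph) (r : pgm G G) :=
  forall u v, (u, v) \in relV r -> u = v.

Lemma subid_id (G : mgraph) : subid (pgm_id G).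
Proof. by move=> u v; rewrite pgm_idE => /eqP. Qed.

Lemma subid0 (G : mgraph) : subid (pgm0 G G).
Proof. by move=> u v; rewrite pgm0E. Qed.

Lemma no_danglingP (P : pregraph) :
  reflect (forall e : pedge P, ~~ dangling e) (~~ has_dangling P).
Proof. exact: existsPn. Qed.

Section OverlapComposite.
Variables (O1 O2 : mgraph) (r1 : pgm O1 O1) (r2 : pgm O2 O2) (m : pgm O2 O1).
Hypotheses (h1 : subid r1) (h2 : subid r2).

(** This interface and the overlap are both built from [O1] and the unmatched part of [O2]. They can
    differ only in the endpoints of edges of [O2], and these agree whenever none is missing. *)
Lemma comp_out_overlap : ~~ has_dangling (comp_out r1 m) ->
  @relgiso (trim (comp_out r1 m)) (overlap m) (@eq_op _)
    (fun e e' => val e == e').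
Proof.
move/no_danglingP=> nd.
have H v x : out_end r1 m v = Some x -> x == overlap_vert m v.
  move/eqP; rewrite out_endE eq_sym overlap_vertE; case: x => // w.
  by case/rcompP=> y h /h1 <-.
split.
- exact: bijrel_eq.
- by apply: bijrel_id.
- move=> [[e|e] he] [e'|e'] //= /eqP[<-] //.
  by apply: H; rewrite ogetK.
- move=> [[e|e] he] [e'|e'] //= /eqP[<-] //.
  by apply: H; rewrite ogetK.
Qed.

(** Here the roles are exchanged: the interface is [O2] with the unmatched part of [O1], so matched
    elements have to be moved to their partners by [ovrel]. *)
Lemma comp_inp_overlap : ~~ has_dangling (comp_inp r2 m) ->
  @relgiso (trim (comp_inp r2 m)) (overlap m)
    (fun x y => ovrel (relV m) x y) (fun e e' => ovrel (relE m) (val e) e').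
Proof.
move/no_danglingP=> nd.
have H v x : inp_end r2 m v = Some x ->
    ovrel (relV m) x (inl v : _ + {v | v \notin rdom (relV m)}).
  move/eqP; rewrite inp_endE; case: x => // w.
  by case/rcompP=> y /h2 ->.
split.
- by apply: bijrel_ov => //; apply: relV_inj.
- apply: (bijrel_subl (R := fun e e' => ovrel (relE m) e e')) => //.
  by apply: bijrel_ov => //; apply: relE_inj.
- move=> [[e|e] he] [e'|e'] //=.
  + exact: relE_src.
  + by move/eqP->; apply: overlap_vert_ovrel.
  + by move/eqP<-; apply: H; rewrite ogetK.
- move=> [[e|e] he] [e'|e'] //=.
  + exact: relE_tgt.
  + by move/eqP->; apply: overlap_vert_ovrel.
  + by move/eqP<-; apply: H; rewrite ogetK.
Qed.

End OverlapComposite.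

Section Tilde.
Variables (O1 O2 : mgraph) (m : pgm O2 O1).

Lemma rcomp_diagl (A B : finType) (r : {set A * B}) : rcomp r (diag A) = r.
Proof.
apply/setP=> -[a b]; apply/rcompP/idP => [[x]|h].
  by rewrite inE => /eqP /= <-.
by exists a => //; rewrite inE.
Qed.

Lemma rcomp_diagr (A B : finType) (r : {set A * B}) : rcomp (diag B) r = r.
Proof.
apply/setP=> -[a b]; apply/rcompP/idP => [[x h]|h].
  by rewrite inE => /eqP /= <-.
by exists b => //; rewrite inE.
Qed.

(** A matched vertex always continues through an identity rule, so no endpoint is ever missing. This
    is why the type of reduction does not matter for [tilde] rules. *)
Lemma tilde_no_dangling :
  ~~ has_dangling (comp_inp (pgm_id O2) m) /\
  ~~ has_dangling (comp_out (pgm_id O1) m).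
Proof.
have I v : inp_end (pgm_id O2) m v.
  have [h|h] := boolP (v \in rim (relV m)).
    have [a ha] := rimP _ _ h.
    suff /eqP-> : inp_end (pgm_id O2) m v == Some (inl a) by [].
    by rewrite inp_endE rcomp_diagl.
  suff /eqP-> : inp_end (pgm_id O2) m v == Some (inr (exist _ v h)) by [].
  by rewrite inp_endE.
have O v : out_end (pgm_id O1) m v.
  have [h|h] := boolP (v \in rdom (relV m)).
    have [a ha] := rdomP _ _ h.
    suff /eqP-> : out_end (pgm_id O1) m v == Some (inl a) by [].
    by rewrite out_endE rcomp_diagr.
  suff /eqP-> : out_end (pgm_id O1) m v == Some (inr (exist _ v h)) by [].
  by rewrite out_endE.
split; apply/no_danglingP; rewrite /dangling => -[e|e] /=; rewrite ?I ?O //.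
Qed.

Lemma glue_diag (A B : finType) (s : {set A * B}) a b :
  (a, b) \in glue_rel (diag B) (diag A) s = ovrel s a b.
Proof.
rewrite in_glue_rel rcomp_diagl rcomp_diagr.
by case: a b => [a|a] [b|b] //=; rewrite inE.
Qed.

(** The relation of the composite is [ovrel], which is also the bijection from the input interface
    to the overlap. Seen through that bijection it becomes the identity. *)
Lemma tilde_comp_iso :
  rule_iso (comp_rule (pgm_id O1) (pgm_id O2) m) (tilde_rule (overlap m)).
Proof.
have [nI nO] := tilde_no_dangling.
have hI := comp_inp_overlap (@subid_id O2) nI.
have hO := comp_out_overlap (@subid_id O1) nO.
apply: (@rule_isoI (comp_rule (pgm_id O1) (pgm_id O2) m)
          (tilde_rule (overlap m)) _ _ _ _ hI hO).
  case: hI => -[_ _ u _] _ _ _ a a' b b' ha /eqP<-.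
  rewrite pgm_idE [LHS]glue_diag; apply/idP/eqP => [h|<-//].
  exact: u ha h.
case: hI => _ [_ _ u _] _ _ a a' b b' ha /eqP<-.
rewrite pgm_idE [LHS]in_set glue_diag; apply/idP/eqP => [h|<-//].
exact: u ha h.
Qed.

Lemma tilde_reduct (T : rtype) :
  reduct T (r := tilde_rule O1) (s := tilde_rule O2) m =
  Some (comp_rule (pgm_id O1) (pgm_id O2) m).
Proof.
by have [/negbTE h1 /negbTE h2] := tilde_no_dangling; rewrite /reduct h1 h2 !andbF.
Qed.

End Tilde.

Lemma rmul_tilde (K : fieldType) (T : rtype) (O1 O2 : mgraph) :
  rmul T (tilde K O1) (tilde K O2) = \sum_(m : pgm O2 O1) tilde K (overlap m).
Proof.
rewrite rmul_delta; apply: eq_bigr => m _; rewrite tilde_reduct /=.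
apply: delta_eq; exact: tilde_comp_iso.
Qed.

(** * Converse matches and commutativity *)

Definition conv (A B : finType) (r : {set A * B}) : {set B * A} :=
  [set p | (p.2, p.1) \in r].

Lemma in_conv (A B : finType) (r : {set A * B}) a b :
  ((b, a) \in conv r) = ((a, b) \in r).
Proof. by rewrite inE. Qed.

Lemma rdom_conv (A B : finType) (r : {set A * B}) : rdom (conv r) = rim r.
Proof.
by apply/setP=> b; apply/rdomP/rimP => -[a h]; exists a; rewrite in_conv in h *.
Qed.

Lemma rim_conv (A B : finType) (r : {set A * B}) : rim (conv r) = rdom r.
Proof.
by apply/setP=> b; apply/rimP/rdomP => -[a h]; exists a; rewrite in_conv in h *.
Qed.

Lemma conv_inj (A B : finType) (r : {set A * B}) :
  one_to_one r -> one_to_one (conv r).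
Proof.
case/one_to_oneP=> u i; apply/one_to_oneP.
by split=> a b c; rewrite !in_conv; [apply: i|apply: u].
Qed.

Fact pgm_conv_ok (G H : mgraph) (m : pgm G H) :
  @pgm_ok H G (conv (relV m), conv (relE m)).
Proof.
apply: pgm_okI; rewrite ?conv_inj ?relV_inj ?relE_inj // => e f.
by rewrite !in_conv => h; split; [apply: relE_src|apply: relE_tgt].
Qed.

Definition pgm_conv (G H : mgraph) (m : pgm G H) : pgm H G :=
  Pgm (pgm_conv_ok m).

Lemma pgm_convK (G H : mgraph) : cancel (@pgm_conv G H) (@pgm_conv H G).
Proof. by move=> m; apply: pgm_eq; apply/setP=> -[a b]; rewrite !inE. Qed.

Lemma pgm_conv_bij (G H : mgraph) : bijective (@pgm_conv G H).
Proof. by exists (@pgm_conv H G); apply: pgm_convK. Qed.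

Lemma overlap_conv (G H : mgraph) (m : pgm G H) :
  giso (overlap (pgm_conv m)) (overlap m).
Proof.
(* This handles the endpoints of those edges of [H] that remain as unmatched edges in the first
   overlap; [H''] below does the same for edges of [G] in the second. *)
have H' v : ovrel (relV m) (overlap_vert (pgm_conv m) v)
    (inl v : _ + {v | v \notin rdom (relV m)}).
  have := overlap_vertE v (overlap_vert (pgm_conv m) v).
  rewrite eqxx; case: (overlap_vert (pgm_conv m) v) => [b|u /esym //] /=.
  by rewrite in_conv.
have H'' v : ovrel (relV m)
    (inl v : _ + {b | b \notin rdom (relV (pgm_conv m))}) (overlap_vert m v).
  have := overlap_vertE v (overlap_vert m v); rewrite eqxx.
  by case: (overlap_vert m v) => [b|u] /= => [<-|/esym/eqP<-].
apply: (@relgiso_giso (overlap (pgm_conv m)) (overlap m)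
  (fun x y => ovrel (relV m) x y) (fun x y => ovrel (relE m) x y)); split.
- by apply: bijrel_ov => // [|b]; rewrite ?relV_inj // rdom_conv.
- by apply: bijrel_ov => // [|b]; rewrite ?relE_inj // rdom_conv.
- move=> [e|e] [e'|e'] //=; first exact: relE_src.
    by move/eqP->; apply: H''.
  by move/eqP<-; apply: H'.
- move=> [e|e] [e'|e'] //=; first exact: relE_tgt.
    by move/eqP->; apply: H''.
  by move/eqP<-; apply: H'.
Qed.

Lemma rmul_tildeC (K : fieldType) (T : rtype) (O1 O2 : mgraph) :
  rmul T (tilde K O1) (tilde K O2) = rmul T (tilde K O2) (tilde K O1).
Proof.
apply: etrans (rmul_tilde K T O1 O2) _.
apply: etrans _ (esym (rmul_tilde K T O2 O1)).
rewrite [LHS](reindex (@pgm_conv O1 O2)) /=; last first.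
  by apply: onW_bij; apply: pgm_conv_bij.
apply: eq_bigr => m _; apply: delta_eq; apply: tilde_iso.
exact: overlap_conv.
Qed.

(** * Spans and composites of rules with empty relation *)

Section Span.
Variables (K : fieldType) (J : Type) (f : J -> ralg K).

Lemma lspan_lin (a : K) x y : lspan f x -> lspan f y -> lspan f (a *: x + y).
Proof.
case=> s -> [t ->]; exists ([seq (a * p.1, p.2) | p <- s] ++ t).
rewrite big_cat big_map scaler_sumr; congr (_ + _).
by apply: eq_bigr => p _; rewrite scalerA.
Qed.

Lemma lspan0 : lspan f 0.
Proof. by exists [::]; rewrite big_nil. Qed.

Lemma lspan_gen j : lspan f (f j).
Proof. by exists [:: (1, j)]; rewrite big_seq1 scale1r. Qed.

Lemma lspan_sum (I : Type) (s : seq I) (P : pred I) (F : I -> ralg K) :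
  (forall i, P i -> lspan f (F i)) -> lspan f (\sum_(i <- s | P i) F i).
Proof.
move=> h; elim/big_ind: _ => [|x y hx hy|//]; first exact: lspan0.
by rewrite -[x]scale1r; apply: lspan_lin.
Qed.

Lemma lspan_ind (Q : ralg K -> Prop) :
  Q 0 -> (forall a j x, Q x -> Q (a *: f j + x)) ->
  forall x, lspan f x -> Q x.
Proof.
move=> Q0 QS x [s ->]; elim: s => [|p s IH]; first by rewrite big_nil.
by rewrite big_cons; apply: QS.
Qed.

Lemma lspan_mul_closed (T : rtype) :
  (forall i j, lspan f (rmul T (f i) (f j))) -> mul_closed T (lspan f).
Proof.
move=> h x y; rewrite /rmul; elim/lspan_ind => [|a i {}x IHx].
  by rewrite bilin0l => _; apply: lspan0.
move=> hy; rewrite bilinDl; apply: lspan_lin (IHx hy).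
elim/lspan_ind: hy {IHx} => [|b j {}y IHy]; first by rewrite bilin0r; apply: lspan0.
by rewrite bilinDr; apply: lspan_lin; first exact: h.
Qed.

(* Stated for an abstract [B]: conversion must not unfold [bilin]. *)
Lemma lspan_bilinear_sym (B : ralg K -> ralg K -> ralg K) :
  (forall z, B 0 z = 0) -> (forall z, B z 0 = 0) ->
  (forall a x y z, B (a *: x + y) z = a *: B x z + B y z) ->
  (forall a x y z, B z (a *: x + y) = a *: B z x + B z y) ->
  (forall i j, B (f i) (f j) = B (f j) (f i)) ->
  forall x y, lspan f x -> lspan f y -> B x y = B y x.
Proof.
move=> B0l B0r Dl Dr h x y hx hy.
elim/lspan_ind: hx => [|a i {}x IHx]; first by rewrite B0l B0r.
rewrite Dl Dr IHx; congr (_ *: _ + _).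
elim/lspan_ind: hy {IHx} => [|b j {}y IHy]; first by rewrite B0l B0r.
by rewrite Dl Dr IHy h.
Qed.

Lemma lspan_commutative (T : rtype) :
  (forall i j, rmul T (f i) (f j) = rmul T (f j) (f i)) ->
  commutative_on T (lspan f).
Proof.
apply: (lspan_bilinear_sym (B := @rmul K T)) => *.
- exact: bilin0l.
- exact: bilin0r.
- exact: bilinDl.
- exact: bilinDr.
Qed.

(** The tool for showing that a vector lies outside a span: it suffices that one of its coefficients
    is non-zero while the same coefficient vanishes on all generators. *)
Lemma lspan_coef0 (c : rclass) x :
  (forall j, mcoeff c (f j) = 0) -> lspan f x -> mcoeff c x = 0.
Proof.
move=> h; elim/lspan_ind => [|a j {}x IHx]; first exact: mcoeff0.
by rewrite [LHS]mcoeffD [X in X + _]mcoeffZ h mulr0 add0r.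
Qed.

End Span.

Lemma delta_coef (K : fieldType) (r s : lrule) :
  mcoeff (class_of s) (delta K r) = (rule_iso r s)%:R.
Proof. by rewrite -class_ofP /delta; apply: mcoeffU. Qed.

Definition point : mgraph :=
  @MGraph unit void (fun e => match e with end) (fun e => match e with end).

Definition loop : mgraph := @MGraph unit unit id id.

(** An isomorphism would carry a vertex of either graph to the other and preserve emptiness of the
    vertex relation, whereas the identity on a non-empty vertex set is non-empty. The vertex may be
    supplied on either side. *)
Lemma tilde_breveN (G H : mgraph) : (vert G + vert H)%type ->
  rule_iso (tilde_rule G) (breve_rule H) = false.
Proof.
move=> w; apply/negbTE/negP=> iso.
have [f [g [hf _ h _]]] := rule_isoE iso.
have /gisosP[[f' _ f'K] _ _ _] := hf.
have v : vert G by case: w => [//|x]; apply: f' x.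
by have := h v v; rewrite pgm_idE pgm0E eqxx.
Qed.

Lemma obs_proper (K : fieldType) : exists x, ~ obs (K := K) x.
Proof.
exists (breve K point) => h.
have h0 G : mcoeff (class_of (breve_rule point)) (tilde K G) = 0.
  by rewrite delta_coef (@tilde_breveN G point (inr tt)).
have := @lspan_coef0 K mgraph (@tilde K) _ _ h0 h; rewrite delta_coef rule_iso_refl.
by move/eqP; rewrite oner_eq0.
Qed.

Lemma obs_pm_proper (K : fieldType) : exists x, ~ obs_pm (K := K) x.
Proof.
exists (tilde K point) => h.
have h0 G : mcoeff (class_of (tilde_rule point)) (breve K G) = 0.
  by rewrite delta_coef rule_iso_sym (@tilde_breveN point G (inl tt)).
have := @lspan_coef0 K mgraph (@breve K) _ _ h0 h; rewrite delta_coef rule_iso_refl.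
by move/eqP; rewrite oner_eq0.
Qed.

Lemma runit_tilde (K : fieldType) : runit K = tilde K empty_graph.
Proof.
apply: delta_eq.
apply: (@rule_isoI (LRule (pgm0 empty_graph empty_graph))
  (tilde_rule empty_graph) _ _ _ _ (gisos_relgiso (gisos_id _))
  (gisos_relgiso (gisos_id _))) => -[].
Qed.

Lemma obs_subalgebra (K : fieldType) (T : rtype) :
  proper_subalgebra T (obs (K := K)).
Proof.
split; last exact: obs_proper.
split.
- by rewrite runit_tilde; apply: (@lspan_gen K mgraph (@tilde K)).
- by move=> a x y; apply: lspan_lin.
- apply: lspan_mul_closed => G H; rewrite rmul_tilde.
  by apply: lspan_sum => m _; apply: lspan_gen.
Qed.

(** For matched vertices [S] and matched edges [F]: no unmatched edge touches a matched vertex. When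
    the relation of the rule is empty, no endpoint can be redirected, and this is the absence of
    dangling edges. *)
Definition clear (G : mgraph) (S : {set vert G}) (F : {set edge G}) : bool :=
  [forall e, (e \notin F) ==> (src e \notin S) && (tgt e \notin S)].

Section HalfBreve.
Variables (A B : mgraph) (DV : {set vert B}) (DE : {set edge B}).
Variable en : vert B -> option (vert A + {v : vert B | v \notin DV})%type.
Hypothesis enE : forall v x,
  (en v == Some x) = (if x is inr u then val u == v else false).

Let P := @half_comp A B _ (fun e => e \notin DE) en.

Lemma half_en_some v : (en v : bool) = (v \notin DV).
Proof.
apply/idP/idP => [|h].
  case e: (en v) => [x|] // _; move/eqP: e; rewrite enE.
  by case: x => // u /eqP<-; apply: (valP u).
suff /eqP-> : en v == Some (inr (exist _ v h)) by [].
by rewrite enE.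
Qed.

Lemma half_dangling : has_dangling P = ~~ clear DV DE.
Proof.
rewrite /clear negb_forall; apply/existsP/existsP => -[e].
  case: e => [e|[e he]] //=; rewrite /dangling /= !half_en_some => h.
  by exists e; rewrite he.
rewrite negb_imply => /andP[he h].
by exists (inr (exist _ e he)); rewrite /dangling /= !half_en_some.
Qed.

(** An edge of [B] dangles exactly when it is incident to a removed vertex, so trimming amounts to
    the graph deletion of [gdel]. *)
Lemma half_giso : giso (trim P) (gsum A (gdel DV DE)).
Proof.
(* An endpoint that exists is a surviving vertex of [B]; the statement holds for any proof [i] of
   existence, as [trim] supplies its own. *)
have H v (i : en v) x : oget i = x -> if x is inr u then val u = v else False.
  move=> <-; have : en v == Some (oget i) by rewrite ogetK.
  by rewrite enE; case: (oget i) => // u /eqP.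
apply: (@relgiso_giso (trim P) (gsum A (gdel DV DE))
  (sumrel (@eq_op _) (@eq_op _))
  (fun x => sumrel (@eq_op _) (fun e e' => val e == val e') (val x))).
split.
- by apply: bijrel_sum; apply: bijrel_eq.
- split.
  + move=> [[e|[e he]] hd]; first by exists (inl e) => /=.
    have h : kept_edge DV DE e.
      move: hd; rewrite /dangling /= !half_en_some negbK => h.
      by rewrite /kept_edge he.
    by exists (inr (exist _ e h)) => /=.
  + move=> [e|[e h]].
      have hd : ~~ @dangling P (inl e) by [].
      by exists (exist _ (inl e) hd) => /=.
    have /and3P[he h1 h2] := h.
    have hd : ~~ @dangling P (inr (exist _ e he)).
      by rewrite /dangling /= !half_en_some h1 h2.
    by exists (exist _ (inr (exist _ e he)) hd) => /=.
  + move=> [[e|e] hd] [a|a] [b|b] //= /eqP h1 /eqP h2; congr (_ _).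
      by rewrite -h1.
    by apply: val_inj; apply: etrans (esym h1) h2.
  + move=> [[e|e] hd] [[e'|e'] hd'] [b|b] //= /eqP h1 /eqP h2;
      apply: val_inj => /=; congr (_ _); first by rewrite h1 h2.
    by apply: val_inj; apply: etrans h1 (esym h2).
- move=> [[e|e] he] [e'|e'] //= /eqP h; first by rewrite h.
  set o := oget _; have := H _ _ o erefl; move: o => [//|u] /= hu.
  by apply/eqP; apply: val_inj => /=; rewrite hu h.
- move=> [[e|e] he] [e'|e'] //= /eqP h; first by rewrite h.
  set o := oget _; have := H _ _ o erefl; move: o => [//|u] /= hu.
  by apply/eqP; apply: val_inj => /=; rewrite hu h.
Qed.

End HalfBreve.

Lemma rule_iso_empty (r : lrule) (G H : mgraph) :
  relV (lrel r) = set0 -> relE (lrel r) = set0 ->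
  giso (inp r) G -> giso (out r) H -> rule_iso r (LRule (pgm0 G H)).
Proof.
case: r => I O r /= rV rE hI hO.
have -> : r = pgm0 I O by apply: pgm_eq.
exact: rule_iso_pgm0.
Qed.

Section Breve.
Variables (O1 O2 : mgraph) (m : pgm O2 O1).

Lemma breve_inp_endE v x : (inp_end (pgm0 O2 O2) m v == Some x) =
  (if x is inr u then val u == v else false).
Proof.
rewrite inp_endE; case: x => // w.
by apply/rcompP => -[y]; rewrite pgm0E.
Qed.

Lemma breve_out_endE v x : (out_end (pgm0 O1 O1) m v == Some x) =
  (if x is inr u then val u == v else false).
Proof.
rewrite out_endE; case: x => // w.
by apply/rcompP => -[y _]; rewrite pgm0E.
Qed.

Lemma breve_inp_dangling : has_dangling (comp_inp (pgm0 O2 O2) m) =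
  ~~ clear (rim (relV m)) (rim (relE m)).
Proof. exact: (half_dangling _ breve_inp_endE). Qed.

Lemma breve_out_dangling : has_dangling (comp_out (pgm0 O1 O1) m) =
  ~~ clear (rdom (relV m)) (rdom (relE m)).
Proof. exact: (half_dangling _ breve_out_endE). Qed.

Lemma breve_reductE (T : rtype) :
  (reduct T (r := breve_rule O1) (s := breve_rule O2) m : bool) =
  (inp_strict T ==> clear (rim (relV m)) (rim (relE m))) &&
  (out_strict T ==> clear (rdom (relV m)) (rdom (relE m))).
Proof.
rewrite /reduct breve_inp_dangling breve_out_dangling.
by case: (inp_strict T); case: (out_strict T); case: clear; case: clear.
Qed.

Lemma breve_glue (A B A' B' : finType) (s : {set B * A'}) :
  glue_rel (set0 : {set A' * B'}) (set0 : {set A * B}) s = set0.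
Proof.
apply/setP=> -[[a|a] [b|b]]; rewrite in_glue_rel !inE //.
by apply/existsP => -[x]; rewrite !inE andbF.
Qed.

Lemma breve_comp_empty (r := comp_rule (pgm0 O1 O1) (pgm0 O2 O2) m) :
  relV (lrel r) = set0 /\ relE (lrel r) = set0.
Proof.
split; first exact: breve_glue.
by apply/setP=> p; rewrite [LHS]in_set breve_glue !inE.
Qed.

Lemma breve_comp_iso :
  rule_iso (comp_rule (pgm0 O1 O1) (pgm0 O2 O2) m)
    (LRule (pgm0 (gsum (del_im m) O2) (gsum O1 (del_dom m)))).
Proof.
have [h1 h2] := breve_comp_empty; apply: rule_iso_empty => //.
  (* The composite lists [O2] before the remainder of [O1]. *)
  apply: giso_trans (gsumC _ _).
  exact: (half_giso _ breve_inp_endE).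
exact: (half_giso _ breve_out_endE).
Qed.

(** Both interfaces are isomorphic to the same graph, so the composite is again a [breve] rule. *)
Lemma breve_comp_overlap :
  clear (rim (relV m)) (rim (relE m)) -> clear (rdom (relV m)) (rdom (relE m)) ->
  rule_iso (comp_rule (pgm0 O1 O1) (pgm0 O2 O2) m) (breve_rule (overlap m)).
Proof.
move=> c1 c2; have [h1 h2] := breve_comp_empty; apply: rule_iso_empty => //.
  apply: relgiso_giso (comp_inp_overlap (@subid0 O2) _).
  by rewrite breve_inp_dangling c1.
apply: relgiso_giso (comp_out_overlap (@subid0 O1) _).
by rewrite breve_out_dangling c2.
Qed.

End Breve.

(** * Connected graphs *)

Lemma breve_contributesE (T : rtype) (O1 O2 : mgraph) (m : pgm O2 O1) :
  contributes T (r := breve_rule O1) (s := breve_rule O2) m =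
  [&& m != pgm0 _ _, inp_strict T ==> clear (rim (relV m)) (rim (relE m)) &
      out_strict T ==> clear (rdom (relV m)) (rdom (relE m))].
Proof. by rewrite -breve_reductE. Qed.

(** Stated for arbitrary graphs, because closure and commutativity concern a span that also contains
    the rules of disconnected graphs. *)
Lemma rmul_breve_DPO (K : fieldType) (O1 O2 : mgraph) :
  rmul DPO (breve K O1) (breve K O2) =
  \sum_(m : pgm O2 O1 | clear (rim (relV m)) (rim (relE m)) &&
                        clear (rdom (relV m)) (rdom (relE m)))
     breve K (overlap m).
Proof.
rewrite rmul_delta [RHS]big_mkcond /=; apply: eq_bigr => m _.
have := breve_reductE m DPO; case: ifP => [/andP[h1 h2]|_].
  rewrite /reduct breve_inp_dangling breve_out_dangling h1 h2 /= => _.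
  by apply: delta_eq; apply: breve_comp_overlap.
by case: (reduct _ _).
Qed.

Lemma rmul_breveC (K : fieldType) (O1 O2 : mgraph) :
  rmul DPO (breve K O1) (breve K O2) = rmul DPO (breve K O2) (breve K O1).
Proof.
apply: etrans (rmul_breve_DPO K O1 O2) _.
apply: etrans _ (esym (rmul_breve_DPO K O2 O1)).
rewrite [LHS](reindex (@pgm_conv O1 O2)) /=; last first.
  by apply: onW_bij; apply: pgm_conv_bij.
(* Passing to the converse match exchanges the two conditions on dangling edges. *)
apply: eq_big => m; first by rewrite !rim_conv !rdom_conv andbC.
by move=> _; apply: delta_eq; apply: breve_iso; apply: overlap_conv.
Qed.

Lemma runit_breve (K : fieldType) : runit K = breve K empty_graph.
Proof. by []. Qed.

Lemma obs_pm_subalgebra (K : fieldType) :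
  proper_subalgebra DPO (obs_pm (K := K)).
Proof.
split; last exact: obs_pm_proper.
split.
- by rewrite runit_breve; apply: (@lspan_gen K mgraph (@breve K)).
- by move=> a x y; apply: (@lspan_lin K mgraph (@breve K)).
- apply: (@lspan_mul_closed K mgraph (@breve K)) => G H.
  rewrite rmul_breve_DPO; apply: lspan_sum => m _.
  exact: (@lspan_gen K mgraph (@breve K)).
Qed.

(** Edges in [F] have both ends in [S], all others have both ends outside, so [S] is closed under
    adjacency and is everything. An edge outside [F] would then have its ends both in and out of
    [S]. *)
Lemma clear_connected (G : mgraph) (S : {set vert G}) (F : {set edge G}) :
  connected G -> (exists v, v \in S) ->
  (forall e, e \in F -> src e \in S /\ tgt e \in S) ->
  clear S F -> (forall v, v \in S) /\ (forall e, e \in F).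
Proof.
case/andP=> _ /forallP cG [v0 hv0] FS /forallP cl.
have ends e : (src e \in S) = (tgt e \in S).
  have [/FS[-> ->]//|h] := boolP (e \in F).
  by have := cl e; rewrite h => /andP[/negbTE-> /negbTE->].
have clS : closed (@adj G) S.
  move=> u v /existsP[e /orP[] /andP[/eqP<- /eqP<-]]; first exact: ends.
  by rewrite ends.
have SV v : v \in S.
  by rewrite -(closed_connect clS (forallP (cG v0) v)).
split=> // e; apply: contraT => h.
by have := cl e; rewrite h SV.
Qed.

Section Match.
Variables (G H : mgraph) (m : pgm G H).

(** A match without vertices has no edges either, since a matched edge brings its matched source. *)
Lemma pgm_neq0 : m != pgm0 G H -> exists p, p \in relV m.
Proof.
move=> m0; apply/set0Pn; apply: contra m0 => /eqP hV.
apply/eqP; apply: pgm_eq => //; apply/setP=> -[e f].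
by rewrite [RHS]inE; apply/negP=> /relE_src; rewrite hV inE.
Qed.

Lemma rim_edge e : e \in rim (relE m) ->
  src e \in rim (relV m) /\ tgt e \in rim (relV m).
Proof.
by case/rimP=> f h; split; apply/rimP;
  [exists (src f); apply: relE_src|exists (tgt f); apply: relE_tgt].
Qed.

Lemma rdom_edge e : e \in rdom (relE m) ->
  src e \in rdom (relV m) /\ tgt e \in rdom (relV m).
Proof.
by case/rdomP=> f h; split; apply/rdomP;
  [exists (src f); apply: relE_src|exists (tgt f); apply: relE_tgt].
Qed.

Definition rim_total : Prop :=
  (forall v, v \in rim (relV m)) /\ (forall e, e \in rim (relE m)).
Definition rdom_total : Prop :=
  (forall v, v \in rdom (relV m)) /\ (forall e, e \in rdom (relE m)).

Lemma clear_rim_total : connected H -> m != pgm0 G H ->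
  clear (rim (relV m)) (rim (relE m)) -> rim_total.
Proof.
move=> cH /pgm_neq0[[u v] h]; apply: clear_connected => //; last exact: rim_edge.
by exists v; apply/rimP; exists u.
Qed.

Lemma clear_rdom_total : connected G -> m != pgm0 G H ->
  clear (rdom (relV m)) (rdom (relE m)) -> rdom_total.
Proof.
move=> cG /pgm_neq0[[u v] h]; apply: clear_connected => //; last exact: rdom_edge.
by exists u; apply/rdomP; exists v.
Qed.

Lemma del_im_total : rim_total -> giso (gsum (del_im m) G) G.
Proof. by case=> h _; apply: gsum_empty => -[v /negP]; apply. Qed.

Lemma del_dom_total : rdom_total -> giso (gsum H (del_dom m)) H.
Proof.
case=> h _; apply: giso_trans (gsumC _ _) _.
by apply: gsum_empty => -[v /negP]; apply.
Qed.

Lemma bijrel_rim (A B : finType) (r : {set A * B}) (P : pred A) :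
  one_to_one r -> (forall a, P a = (a \in rdom r)) ->
  (forall b, b \in rim r) ->
  bijrel (fun b (a : {a | P a}) => (val a, b) \in r).
Proof.
case/one_to_oneP=> u i hP t; split.
- move=> b; have [a h] := rimP _ _ (t b).
  have Pa : P a by rewrite hP; apply/rdomP; exists b.
  by exists (exist _ a Pa).
- by case=> a Pa; have := Pa; rewrite hP => /rdomP[b h]; exists b.
- by move=> b a a' h h'; apply: val_inj; apply: i h h'.
- by move=> b b' a; apply: u.
Qed.

Lemma rim_total_subgraph : rim_total -> subgraph_iso H G.
Proof.
case=> tV tE; apply/existsP.
(* The copy of [H] inside [G] is the domain of [m], so its complement is deleted. *)
exists (~: rdom (relV m), ~: rdom (relE m)) => /=.
(* Deleting the unmatched vertices removes no matched edge, because the ends of a matched edge are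
   matched. *)
have kE e : kept_edge (~: rdom (relV m)) (~: rdom (relE m)) e =
    (e \in rdom (relE m)).
  rewrite /kept_edge !inE !negbK.
  by case: (boolP (e \in _)) => //= /rdom_edge[-> ->].
apply: (@relgiso_giso H (gdel (~: rdom (relV m)) (~: rdom (relE m)))
  (fun b a => (val a, b) \in relV m) (fun b a => (val a, b) \in relE m)).
split.
- apply: (@bijrel_rim _ _ (relV m)) => // [|a]; first exact: relV_inj.
  by rewrite !inE negbK.
- by apply: (@bijrel_rim _ _ (relE m)) => //; apply: relE_inj.
- by move=> e [e' he'] /= /relE_src.
- by move=> e [e' he'] /= /relE_tgt.
Qed.

Lemma total_relgiso : rim_total -> rdom_total ->
  @relgiso H G (fun b a => (a, b) \in relV m) (fun b a => (a, b) \in relE m).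
Proof.
have bij (A B : finType) (r : {set A * B}) : one_to_one r ->
    (forall b, b \in rim r) -> (forall a, a \in rdom r) ->
    bijrel (fun b a => (a, b) \in r).
  case/one_to_oneP=> u i tr td; split.
  - by move=> b; case/rimP: (tr b) => a; exists a.
  - by move=> a; case/rdomP: (td a) => b; exists b.
  - by move=> b a a'; apply: i.
  - by move=> b b' a; apply: u.
case=> rV rE [dV dE]; split.
- by apply: bij => //; apply: relV_inj.
- by apply: bij => //; apply: relE_inj.
- by move=> e e' /relE_src.
- by move=> e e' /relE_tgt.
Qed.

End Match.

Lemma rdom_total_subgraph (G H : mgraph) (m : pgm G H) :
  rdom_total m -> subgraph_iso G H.
Proof.
case=> tV tE; apply: (@rim_total_subgraph _ _ (pgm_conv m)).
by split=> x; rewrite /relV /relE /= rim_conv.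
Qed.

(** Every index of the sum forces the guard, so if the guard fails the sum is empty. *)
Lemma guard_sum (K : fieldType) (I : finType) (P : pred I) (b : bool) (F G : I -> ralg K) :
  (forall i, P i -> b) -> (forall i, P i -> F i = G i) ->
  \sum_(i | P i) F i = b%:R *: \sum_(i | P i) G i.
Proof.
move=> hb hF; rewrite (eq_bigr _ hF).
case: b hb => hb; first by rewrite scale1r.
by rewrite scale0r big_pred0 // => i; apply/negP => /hb.
Qed.

(** The converse of the graph of [f]: matches go from [O2] to [O1], whereas isomorphisms are counted
    from [O1] to [O2]. *)
Definition graph_rel (G H : mgraph)
    (f : {ffun vert G -> vert H} * {ffun edge G -> edge H}) :
    {set vert H * vert G} * {set edge H * edge G} :=
  ([set p | f.1 p.2 == p.1], [set p | f.2 p.2 == p.1]).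

Lemma graph_rel_inj (G H : mgraph) : injective (@graph_rel G H).
Proof.
move=> [f f'] [g g'] [] /setP e /setP e'; congr (_, _); apply/ffunP=> x.
  by have := e (f x, x); rewrite !inE /= eqxx => /esym/eqP.
by have := e' (f' x, x); rewrite !inE /= eqxx => /esym/eqP.
Qed.

Lemma graph_rel_ok (G H : mgraph) f :
  f \in gisos G H -> @pgm_ok H G (graph_rel f).
Proof.
case/gisosP=> b1 b2 hs ht.
have inj (A B : finType) (g : {ffun A -> B}) : bijective g ->
    one_to_one [set p : B * A | g p.2 == p.1].
  move=> gB; apply/one_to_oneP; split=> a b c; rewrite !inE /=.
    by move=> /eqP<- /eqP/(bij_inj gB).
  by move=> /eqP<- /eqP.
apply: pgm_okI; [exact: inj|exact: inj|] => e e'.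
by rewrite !inE /= => /eqP<-; rewrite hs ht.
Qed.

Lemma card_gisos_le (G H L : mgraph) g : g \in gisos H L ->
  (#|gisos G H| <= #|gisos G L|)%N.
Proof.
move=> hg; have /gisosP[b1 b2 _ _] := hg.
pose F (f : {ffun vert G -> vert H} * {ffun edge G -> edge H}) :
    {ffun vert G -> vert L} * {ffun edge G -> edge L} :=
  ([ffun v => g.1 (f.1 v)], [ffun e => g.2 (f.2 e)]).
have FI : injective F.
  move=> [f f'] [k k'] [] /ffunP e /ffunP e'.
  congr (_, _); apply/ffunP=> x.
    by have := e x; rewrite !ffunE => /(bij_inj b1).
  by have := e' x; rewrite !ffunE => /(bij_inj b2).
rewrite -(card_imset _ FI); apply: subset_leq_card.
by apply/subsetP=> _ /imsetP[f hf ->]; apply: gisos_comp hf hg.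
Qed.

(** Composing with one fixed isomorphism, and with its inverse, injects automorphisms into
    isomorphisms and conversely. *)
Lemma card_gisos (G H : mgraph) :
  (#|gisos G H| = giso G H * #|Aut G|)%N.
Proof.
rewrite /giso; case: eqP => [->|/eqP/set0Pn[g hg]]; first by rewrite cards0.
rewrite mul1n; apply/eqP; rewrite eqn_leq (card_gisos_le _ hg) andbT.
by have [g' hg' _] := gisos_inv hg; apply: card_gisos_le hg'.
Qed.

(** * Product formulas for rules with empty relation *)

Lemma nontriv_breve (K : fieldType) (T : rtype) (O1 O2 : mgraph) :
  nontriv_mul T (breve K O1) (breve K O2) =
  \sum_(m : pgm O2 O1
         | contributes T (r := breve_rule O1) (s := breve_rule O2) m)
     delta K (LRule (pgm0 (gsum (del_im m) O2) (gsum O1 (del_dom m)))).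
Proof.
rewrite nontriv_delta; apply: eq_bigr => m _; apply: delta_eq.
exact: breve_comp_iso.
Qed.

Section ConnectedBreve.
Variables (K : fieldType) (O1 O2 : mgraph).
Hypotheses (c1 : connected O1) (c2 : connected O2).

(** Strictness of the input interface forces a contributing match to cover [O1]. Hence nothing of
    [O1] remains on the input side, and [O1] embeds in [O2]. *)
Lemma nontriv_breve_SPOA :
  nontriv_mul SPOA (breve K O1) (breve K O2) =
  (subgraph_iso O1 O2)%:R *:
  \sum_(m : pgm O2 O1
         | contributes SPOA (r := breve_rule O1) (s := breve_rule O2) m)
     delta K (LRule (pgm0 O2 (gsum O1 (del_dom m)))).
Proof.
have tot m : contributes SPOA (r := breve_rule O1) (s := breve_rule O2) m ->
    rim_total m.
  by rewrite breve_contributesE /= andbT => /andP[]; apply: clear_rim_total.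
rewrite nontriv_breve; apply: guard_sum => m /tot t.
  exact: rim_total_subgraph t.
apply: delta_eq; apply: rule_iso_pgm0; first exact: del_im_total.
exact: giso_refl.
Qed.

(** Dually, strictness of the output interface forces a contributing match to cover [O2]. *)
Lemma nontriv_breve_SPOB :
  nontriv_mul SPOB (breve K O1) (breve K O2) =
  (subgraph_iso O2 O1)%:R *:
  \sum_(m : pgm O2 O1
         | contributes SPOB (r := breve_rule O1) (s := breve_rule O2) m)
     delta K (LRule (pgm0 (gsum (del_im m) O2) O1)).
Proof.
have tot m : contributes SPOB (r := breve_rule O1) (s := breve_rule O2) m ->
    rdom_total m.
  by rewrite breve_contributesE /= => /andP[]; apply: clear_rdom_total.
rewrite nontriv_breve; apply: guard_sum => m /tot t.
  exact: rdom_total_subgraph t.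
apply: delta_eq; apply: rule_iso_pgm0; first exact: giso_refl.
exact: del_dom_total.
Qed.

(** A contributing match is total on both sides, hence the converse of the graph of an isomorphism,
    and every isomorphism arises in this way. *)
Lemma card_contributes_DPO :
  #|[pred m : pgm O2 O1
     | contributes DPO (r := breve_rule O1) (s := breve_rule O2) m]| =
  #|gisos O1 O2|.
Proof.
(* Both sides are embedded in the pairs of relations, where they become the same set. *)
rewrite -(card_imset _ (@graph_rel_inj O1 O2)).
rewrite -(card_imset _ (val_inj : injective (@pgm_val O2 O1))).
apply: eq_card => x; apply/imsetP/imsetP => [[m]|[f hf ->]].
  rewrite inE breve_contributesE /= => /and3P[m0 h1 h2] ->.
  have t1 := clear_rim_total c1 m0 h1; have t2 := clear_rdom_total c2 m0 h2.
  have [f hf [fV fE]] := relgiso_gisos (total_relgiso t1 t2).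
  exists f => //; rewrite [LHS]surjective_pairing; congr (_, _).
    by apply/setP=> -[a b]; rewrite inE -fV.
  by apply/setP=> -[a b]; rewrite inE -fE.
exists (Pgm (graph_rel_ok hf)) => //.
have /gisosP[[g1 fK1 gK1] [g2 fK2 gK2] _ _] := hf.
have inE1 a b : ((a, b) \in relV (Pgm (graph_rel_ok hf))) = (f.1 b == a).
  by rewrite inE.
have inE2 a b : ((a, b) \in relE (Pgm (graph_rel_ok hf))) = (f.2 b == a).
  by rewrite inE.
rewrite inE breve_contributesE /=; apply/and3P; split.
(* Connected graphs have a vertex, which makes the match non-trivial. *)
- case/andP: c1 => /card_gt0P[v _] _; apply/eqP=> e.
  have : (f.1 v, v) \in relV (Pgm (graph_rel_ok hf)) by rewrite inE1.
  by rewrite e pgm0E.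
(* No edge is left unmatched, so the conditions on dangling edges hold vacuously. *)
- apply/forallP=> e; apply/implyP => /negP[]; apply/rimP.
  by exists (f.2 e); rewrite inE2.
- apply/forallP=> e; apply/implyP => /negP[]; apply/rdomP.
  by exists (g2 e); rewrite inE2 gK2.
Qed.

Lemma nontriv_breve_DPO :
  nontriv_mul DPO (breve K O1) (breve K O2) =
  ((giso O1 O2)%:R * #|Aut O1|%:R) *: breve K O1.
Proof.
rewrite nontriv_breve (eq_bigr (fun _ => breve K O1)); last first.
  move=> m; rewrite breve_contributesE /= => /and3P[m0 h1 h2].
  have t1 := clear_rim_total c1 m0 h1; have t2 := clear_rdom_total c2 m0 h2.
  apply: delta_eq; apply: rule_iso_pgm0; last exact: del_dom_total.
  apply: giso_trans (del_im_total t1) _; apply: giso_sym.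
  exact: relgiso_giso (total_relgiso t1 t2).
rewrite sumr_const card_contributes_DPO card_gisos -natrM.
by rewrite scaler_nat.
Qed.

End ConnectedBreve.

(** * Failure of closure for the types other than DPO *)

Lemma breve_sum_iso (G H : mgraph) :
  rule_iso (rule_sum (breve_rule G) (breve_rule H)) (breve_rule (gsum G H)).
Proof.
apply: rule_iso_empty; try exact: giso_refl;
  by apply/setP=> -[[a|a] [b|b]]; rewrite !inE.
Qed.

(** The trivial match contributes an element of the span, so the single other composite would lie in
    it too. Its coefficient is 1, non-zero in every characteristic, while no [breve] rule is
    isomorphic to a rule with non-isomorphic interfaces. *)
Lemma breve_not_mul_closed (K : fieldType) (T : rtype) (O1 O2 : mgraph)
    (m1 : pgm O2 O1) :
  (forall m,
     contributes T (r := breve_rule O1) (s := breve_rule O2) m = (m == m1)) ->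
  ~~ giso (gsum (del_im m1) O2) (gsum O1 (del_dom m1)) ->
  ~ mul_closed T (obs_pm (K := K)).
Proof.
move=> uniq ng closed_mul.
set s := LRule (pgm0 (gsum (del_im m1) O2) (gsum O1 (del_dom m1))).
have gen G : obs_pm (breve K G) by apply: (@lspan_gen K mgraph (@breve K)).
have : obs_pm (delta K s).
  have <- : nontriv_mul T (breve K O1) (breve K O2) = delta K s.
    by rewrite nontriv_breve (big_pred1 m1).
  rewrite /nontriv_mul addrC -scaleN1r.
  apply: (@lspan_lin K mgraph (@breve K)); last exact: closed_mul.
  rewrite superpose_delta (delta_eq _ (breve_sum_iso _ _)); exact: gen.
have h0 G : mcoeff (class_of s) (breve K G) = 0.
  rewrite delta_coef; case e: (rule_iso _ _) => //.
  have [f [g [hf hg _ _]]] := rule_isoE e; case/negP: ng.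
  apply: giso_trans (_ : giso _ G) _; last by apply/gisoP; exists g.
  by apply: giso_sym; apply/gisoP; exists f.
move=> h; have := @lspan_coef0 K mgraph (@breve K) _ _ h0 h.
by rewrite delta_coef rule_iso_refl; move/eqP; rewrite oner_eq0.
Qed.

Fact vertex_match_ok (G H : mgraph) (v : vert G) (w : vert H) :
  @pgm_ok G H ([set (v, w)], set0).
Proof.
apply: pgm_okI => [||e f]; last by rewrite inE.
  apply/one_to_oneP; split=> a b c; rewrite !in_set1.
    by move=> /eqP[_ ->] /eqP[_ ->].
  by move=> /eqP[-> _] /eqP[-> _].
by apply/one_to_oneP; split=> a b c; rewrite in_set0.
Qed.

Definition vertex_match (G H : mgraph) (v : vert G) (w : vert H) : pgm G H :=
  Pgm (vertex_match_ok v w).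

(** With one vertex on each side and edges on at most one side, a non-empty match can only pair the
    two vertices. *)
Lemma vertex_match_uniq (G H : mgraph) (v : vert G) (w : vert H) (m : pgm G H) :
  (forall x, x = v) -> (forall y, y = w) ->
  (edge G -> False) \/ (edge H -> False) ->
  (m != pgm0 G H) = (m == vertex_match v w).
Proof.
move=> hG hH hE; apply/idP/eqP => [/pgm_neq0[[x y] h]|->]; last first.
  apply/eqP=> e; have : (v, w) \in relV (vertex_match v w) by rewrite !inE.
  by rewrite e pgm0E.
apply: pgm_eq; last first.
  by apply/setP=> -[e f]; case: hE => [/(_ e)|/(_ f)].
by apply/setP=> -[a b]; rewrite !inE (hG a) (hH b) eqxx -(hG x) -(hH y) h.
Qed.

Lemma obs_pm_not_mul_closed (K : fieldType) (T : rtype) :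
  T <> DPO -> ~ mul_closed T (obs_pm (K := K)).
Proof.
have vert1 (x : unit) : x = tt by case: x.
(* Along [m1] the loop belongs to [O2] and dangles in the output interface only, which SPOA and
   SPOAB delete; along [m2] it belongs to [O1] and dangles in the input interface only, as SPOB
   allows. *)
pose m1 := @vertex_match loop point tt tt.
pose m2 := @vertex_match point loop tt tt.
have c1 : clear (rim (relV m1)) (rim (relE m1)) by apply/forallP => -[].
have c2 : clear (rdom (relV m2)) (rdom (relE m2)) by apply/forallP => -[].
have n1 : ~~ giso (gsum (del_im m1) loop) (gsum point (del_dom m1)).
  (* The left graph still has the loop, while the right one has no edge to send it to. *)
  apply/negP=> /gisoP[f _].
  case: (f.2 (inr tt)) => [[]|[e he]]; case/and3P: (he) => _ /negP[].
  by apply/rdomP; exists tt; rewrite !inE.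
have n2 : ~~ giso (gsum (del_im m2) point) (gsum loop (del_dom m2)).
  (* Now the loop survives on the right only, so the isomorphism is reversed before following the
     edge. *)
  apply/negP=> /giso_sym/gisoP[f _].
  case: (f.2 (inl tt)) => [[e he]|[]]; case/and3P: (he) => _ /negP[].
  by apply/rimP; exists tt; rewrite !inE.
have u1 m : (m != pgm0 loop point) = (m == m1).
  by apply: vertex_match_uniq => //; right.
have u2 m : (m != pgm0 point loop) = (m == m2).
  by apply: vertex_match_uniq => //; left.
case: T => // _.
- apply: (breve_not_mul_closed _ n1) => m.
  by rewrite breve_contributesE /= andbT u1; case: eqP => // ->.
- apply: (breve_not_mul_closed _ n2) => m.
  by rewrite breve_contributesE /= u2; case: eqP => // ->.
- apply: (breve_not_mul_closed _ n1) => m.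
  by rewrite breve_contributesE /= !andbT u1.
Qed.

Lemma nontriv_tilde (K : fieldType) (T : rtype) (O1 O2 : mgraph) :
  nontriv_mul T (tilde K O1) (tilde K O2) =
  \sum_(m : pgm O2 O1
         | contributes T (r := tilde_rule O1) (s := tilde_rule O2) m)
     delta K (LRule (pgm_id (overlap m))).
Proof.
rewrite nontriv_delta; apply: eq_bigr => m _; apply: delta_eq.
exact: tilde_comp_iso.
Qed.

Theorem theorem6p4 (K : fieldType) :
  [/\ forall O1 O2 : mgraph, connected O1 -> connected O2 ->
      [/\ forall T : rtype,
            nontriv_mul T (tilde K O1) (tilde K O2) =
            \sum_(m : pgm O2 O1
                   | contributes T (r := tilde_rule O1) (s := tilde_rule O2) m)
               delta K (LRule (pgm_id (overlap m))),
          nontriv_mul DPO (breve K O1) (breve K O2) =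
            ((giso O1 O2)%:R * #|Aut O1|%:R) *: breve K O1,
          nontriv_mul SPOA (breve K O1) (breve K O2) =
            (subgraph_iso O1 O2)%:R *:
            \sum_(m : pgm O2 O1
                   | contributes SPOA (r := breve_rule O1) (s := breve_rule O2) m)
               delta K (LRule (pgm0 O2 (gsum O1 (del_dom m)))),
          nontriv_mul SPOB (breve K O1) (breve K O2) =
            (subgraph_iso O2 O1)%:R *:
            \sum_(m : pgm O2 O1
                   | contributes SPOB (r := breve_rule O1) (s := breve_rule O2) m)
               delta K (LRule (pgm0 (gsum (del_im m) O2) O1))
        & nontriv_mul SPOAB (breve K O1) (breve K O2) =
            \sum_(m : pgm O2 O1
                   | contributes SPOAB (r := breve_rule O1) (s := breve_rule O2) m)
               delta K (LRule (pgm0 (gsum (del_im m) O2)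
                                    (gsum O1 (del_dom m))))],
      forall T : rtype, proper_subalgebra T (obs (K := K)),
      proper_subalgebra DPO (obs_pm (K := K))
    & forall T : rtype, T <> DPO ->
        ~ subalgebra T (obs_pm (K := K)) /\ ~ mul_closed T (obs_pm (K := K))]
  /\ ((forall T : rtype, commutative_on T (obs (K := K))) /\
      commutative_on DPO (obs_pm (K := K))).
Proof.
split; last first.
  split=> [T|].
    exact: (@lspan_commutative K mgraph (@tilde K) T (rmul_tildeC K T)).
  exact: (@lspan_commutative K mgraph (@breve K) DPO (rmul_breveC K)).
split.
- move=> O1 O2 c1 c2; split.
  + move=> T; exact: nontriv_tilde.
  + exact: nontriv_breve_DPO.
  + exact: nontriv_breve_SPOA.
  + exact: nontriv_breve_SPOB.
  + exact: nontriv_breve.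
- exact: obs_subalgebra.
- exact: obs_pm_subalgebra.
- move=> T /obs_pm_not_mul_closed h; split; last exact: h.
  by case=> _ _; apply: h.
Qed.
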